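(* For any countable limit ordinal $\alpha$ there exists a label $\mathcal M$ which is both simple and finitary with height $=$ height$^*$ $=\alpha+1$. For any countable ordinal $\alpha$ there exists a label $\mathcal M$ which is both simple and finitary with height $=\alpha+1$. Hence, for such $\mathcal M$, $(X(\mathcal M),S)$ and $(X_+(\mathcal M),S)$ are topologically transitive WAP subshifts with height $=\alpha+1$ and, if $\alpha$ is a limit ordinal (and $\mathcal M$ is as in the first assertion), with height$^*$ $=\alpha+1$.
   Context: LABELS. Write $\mathbb N=\{1,2,\dots\}$. An $\mathbb N$-vector is a function $\mathbf m:\mathbb N\to\{0,1,2,\dots\}$ with finite support $\mathrm{supp}\,\mathbf m$; $FIN(\mathbb N)$ is the additive monoid of all $\mathbb N$-vectors, with identity $\mathbf 0$ and the pointwise order. A label is a set $\mathcal M\subset FIN(\mathbb N)$ such that $\mathbf 0\le\mathbf m_1\le\mathbf m\in\mathcal M$ implies $\mathbf m_1\in\mathcal M$; $\emptyset$ and $0=\{\mathbf 0\}$ are labels. $\mathcal{LAB}$ is the compact space of all labels with the ultrametric $d(\mathcal M_1,\mathcal M_2)=\inf\{2^{-N}:N\ge0,\ \mathcal M_1\cap\mathcal B_N=\mathcal M_2\cap\mathcal B_N\}$, where $\mathcal B_N$ is the set of $\mathbb N$-vectors $\mathbf m$ with $\mathbf m_\ell<N$ for all $\ell$ and $\mathrm{supp}\,\mathbf m\subset[1,N]$. $FIN(\mathbb N)$ acts by $P_{\mathbf r}(\mathcal M)=\mathcal M-\mathbf r=\{\mathbf w\in FIN(\mathbb N):\mathbf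 w+\mathbf r\in\mathcal M\}$. $\Theta(\mathcal M)$ is the closure of $\{\mathcal M-\mathbf r:\mathbf r\in FIN(\mathbb N)\}$ and $\Theta'(\mathcal M)$ the closure of $\{\mathcal M-\mathbf r:\mathbf r\ne\mathbf 0\}$. $\mathcal M$ is simple if $\Theta(\mathcal M)=\{\mathcal M-\mathbf r:\mathbf r\in FIN(\mathbb N)\}$. $\mathcal M$ is finitary if $\sup_{\mathbf m\in\mathcal M}\mathbf m_\ell<\infty$ for each $\ell$ and, whenever $\{\mathbf r^i\}$ is a sequence of $\mathbb N$-vectors with $\bigcup_i\mathrm{supp}\,\mathbf r^i$ infinite, $\bigcup_i\bigcap_{j\ge i}(\mathcal M-\mathbf r^j)$ is finite. HEIGHTS OF LABELS. For a closed $FIN(\mathbb N)$-invariant $\Phi\subset\mathcal{LAB}$, $z_{LAB}(\Phi)$ is the closure of $\bigcup_{\mathbf r\ne\mathbf 0}P_{\mathbf r}(\Phi)$; set $z_{LAB,0}(\Phi)=\Phi$, $z_{LAB,\alpha+1}(\Phi)=z_{LAB}(z_{LAB,\alpha}(\Phi))$, and $z_{LAB,\beta}(\Phi)=\bigcap_{\alpha<\beta}z_{LAB,\alpha}(\Phi)$ for limit $\beta$. For $\Phi\subset\Theta(\mathcal M)$ such that $\mathcal N\in\Phi$ implies $\Theta(\mathcal N)\subset\Phi$, $z^*_{\mathcal M}(\Phi)=\{\mathcal N\in\Theta(\mathcal M):\Theta'(\mathcal N)\subset\Phi\}$; set $z^*_{\mathcal M,0}(\Phi)=\Phi$, $z^*_{\mathcal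 M,\alpha+1}(\Phi)=z^*_{\mathcal M}(z^*_{\mathcal M,\alpha}(\Phi))$, and $z^*_{\mathcal M,\beta}(\Phi)=\bigcup_{\alpha<\beta}z^*_{\mathcal M,\alpha}(\Phi)$ for limit $\beta$. For a nonempty WAP label $\mathcal M$ (WAP: every element of the closure of $\{P_{\mathbf r}|\Theta(\mathcal M)\}$ in $\Theta(\mathcal M)^{\Theta(\mathcal M)}$ is continuous; simple labels and finitary labels are WAP), the height of $\mathcal M$ (or of $\Theta(\mathcal M)$) is $\alpha+1$ where $\alpha$ is the ordinal with $z_{LAB,\alpha}(\Theta(\mathcal M))=\{\emptyset,0\}$, and the height$^*$ is $\alpha+1$ where $\alpha$ is the ordinal with $z^*_{\mathcal M,\alpha}(\{\emptyset\})=\Theta'(\mathcal M)$. SUBSHIFTS. Fix an odd integer $b\ge5$ and a partition $\{D_\ell:\ell\in\mathbb N\}$ of $\mathbb N$ into infinite sets with $\min D_\ell<\min D_{\ell+1}$. Define $k:\mathbb Z\to\mathbb Z$ by $k(n)=b^{n-1}$ for $n\ge1$, $k(0)=0$, $k(-n)=-k(n)$. $IP(k)$ (resp. $IP_+(k)$) is the set of sums of finite subsets of $k(\mathbb Z)$ (resp. of $k(\{0,1,2,\dots\})$). Each $t\in IP(k)$ has a unique expansion $t=k(j_1)+\dots+k(j_r)$ with $|j_1|>\dots>|j_r|>0$ ($r=0$ for $t=0$); $\mathbf r(t)_\ell=\#\{i:|j_i|\in D_\ell\}$. $A[\mathcal M]=\{t\in IP(k):\mathbf r(t)\in\mathcal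 M\}$ and $A_+[\mathcal M]=A[\mathcal M]\cap IP_+(k)$. $X(\mathcal M)$, $X_+(\mathcal M)\subset\{0,1\}^{\mathbb Z}$ are the orbit closures of the characteristic functions of $A[\mathcal M]$, $A_+[\mathcal M]$ under the shift $S(x)_t=x_{t+1}$; $e$ is the zero sequence. HEIGHTS OF SYSTEMS. For a homeomorphism $T$ of a compact metrizable $X$, $R_T(x)$ is the set of limit points of $\{T^nx\}$ as $n\to\infty$ or $n\to-\infty$. For a closed invariant $Y$, $z_{LIM}(Y)=\overline{\bigcup_{x\in Y}R_T(x)}$; iterate transfinitely starting with $z_0=X$, $z_{\alpha+1}=z_{LIM}(z_\alpha)$, $z_\beta=\bigcap_{\alpha<\beta}z_\alpha$ for limit $\beta$. The height of $(X,T)$ is the first ordinal $\beta$ with $z_{\beta}=z_{\beta+1}$. Let $z^*_0=\{e\}$, $z^*_{\alpha+1}=\{x:R_T(x)\subset z^*_\alpha\}$, $z^*_\beta=\bigcup_{\alpha<\beta}z^*_\alpha$ for limit $\beta$; for a WAP subshift whose only recurrent point is the fixed point $e$, the height$^*$ is the first ordinal $\beta$ with $z^*_\beta=X$. $(X,T)$ is topologically transitive if for all nonempty open $U,V$ there is $n\in\mathbb Z$ with $T^{-n}U\cap V\ne\emptyset$, and WAP if every element of the closure of $\{T^n:n\in\mathbb Z\}$ in $X^X$ (pointwise convergence) is continuous. *)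

(* Defs.v *)
Set Warnings "-notation-incompatible-prefix,-notation-overridden,-ambiguous-paths,-redundant-canonical-projection".
From HB Require Import structures.
From mathcomp Require Import all_boot all_order all_algebra finmap multiset.
From mathcomp Require Import zify.
From mathcomp Require Import all_classical reals Rstruct topology.

Set Implicit Arguments.
Unset Strict Implicit.
Unset Printing Implicit Defensive.

Import Order.TTheory GRing.Theory Num.Theory.

Local Open Scope classical_set_scope.
Local Open Scope ring_scope.

(* An ordinal is presented by a well-ordered type of that order type; its
   elements stand for the smaller ordinals. *)
Record Ord := MkOrd {
  ord_car :> Type;
  ord_lt : ord_car -> ord_car -> Prop;
  ord_wf : well_founded ord_lt;
  ord_trans : forall x y z, ord_lt x y -> ord_lt y z -> ord_lt x z;
  ord_total : forall x y, ord_lt x y \/ x = y \/ ord_lt y x }.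

Definition countable_ordinal (a : Ord) := countable [set: a].

(* [None] is the new top element: in [osucc a] it stands for the ordinal [a]
   itself, and [Some w] for the ordinal that [w] stands for in [a]. *)
Definition osucc_lt (a : Ord) (x y : option a) : Prop :=
  match x, y with
  | Some v, Some w => ord_lt v w
  | Some _, None => True
  | None, _ => False
  end.

Lemma osucc_wf (a : Ord) : well_founded (@osucc_lt a).
Proof.
have accS (w : a) : Acc (@osucc_lt a) (Some w).
  elim/(well_founded_ind (@ord_wf a)): w => w IH.
  by constructor => -[v|//] /IH.
by case=> [w|]; [exact: accS | constructor => -[v|//] _; exact: accS].
Qed.

Lemma osucc_trans (a : Ord) (x y z : option a) :
  osucc_lt x y -> osucc_lt y z -> osucc_lt x z.
Proof. by case: x y z => [x|] [y|] [z|] //=; exact: ord_trans. Qed.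

Lemma osucc_total (a : Ord) (x y : option a) :
  osucc_lt x y \/ x = y \/ osucc_lt y x.
Proof.
case: x y => [x|] [y|] /=; try by auto.
by case: (ord_total x y) => [|[->|]]; auto.
Qed.

Definition osucc (a : Ord) : Ord :=
  MkOrd (@osucc_wf a) (@osucc_trans a) (@osucc_total a).

Definition is_limit_ordinal (a : Ord) :=
  (exists w : a, True) /\ (forall v : a, exists w : a, ord_lt v w).

Section Element_kinds.
Variable a : Ord.
Implicit Types v w : a.

Definition is_zero w := forall v, ~ ord_lt v w.

Definition is_succ_of v w :=
  ord_lt v w /\ forall u, ord_lt u w -> u = v \/ ord_lt u v.

Definition is_limit w := ~ is_zero w /\ forall v, ~ is_succ_of v w.

End Element_kinds.

Section Iteration.
Variables (X : Type) (step : set X -> set X) (lim : set (set X) -> set X).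
Variables (start : set X) (a : Ord).

Definition iter_body (w : a) (rec : forall v, ord_lt v w -> set X) : set X :=
  [set x |
    (is_zero w /\ start x) \/
    (exists v (vw : ord_lt v w), is_succ_of v w /\ step (rec v vw) x) \/
    (is_limit w /\ lim [set A | exists v (vw : ord_lt v w), A = rec v vw] x)].

(* The stage with index [w] of the iteration of [step] from [start]; [lim]
   combines the family of all earlier stages at the limit indices. *)
Definition stage : a -> set X :=
  Fix (@ord_wf a) (fun _ => set X) iter_body.

Lemma stageE w : stage w = iter_body (fun v (_ : ord_lt v w) => stage v).
Proof.
apply: (Fix_eq (@ord_wf a) (fun=> set X) iter_body) => {}w f g fg.
suff -> : f = g by [].
apply: functional_extensionality_dep => v.
by apply: functional_extensionality_dep => vw; exact: fg.
Qed.

Lemma stage_zero w : is_zero w -> stage w = start.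
Proof.
move=> w0; rewrite stageE; apply/seteqP; split=> x.
- by case=> [[]//|[[v [vw _]]|[[/(_ w0)//]]]]; case: (w0 v).
- by left.
Qed.

Lemma stage_succ v w : is_succ_of v w -> stage w = step (stage v).
Proof.
move=> vw; rewrite stageE; apply/seteqP; split=> x.
- case=> [[/(_ v)]|[[u [uw [[_ uS] su]]]|[[_ /(_ v)]//]]].
    by case; case: vw.
  have [vltw vS] := vw.
  have [vu|vu] := uS _ vltw; first by rewrite vu.
  have [uv|uv] := vS _ uw; first by rewrite -uv.
  have irr : forall t : a, ~ ord_lt t t.
    move=> t; elim/(well_founded_ind (@ord_wf a)): t => t IH tt.
    exact: (IH t tt tt).
  by case: (irr v); exact: ord_trans vu uv.
- by move=> sx; right; left; exists v; have [vltw _] := vw; exists vltw.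
Qed.

Lemma stage_limit w : is_limit w ->
  stage w = lim [set stage v | v in [set v | ord_lt v w]].
Proof.
move=> wl; rewrite stageE.
have -> : [set stage v | v in [set v | ord_lt v w]] =
          [set A | exists v (_ : ord_lt v w), A = stage v].
  apply/seteqP; split=> A.
    by case=> v vw <-; exists v, vw.
  by case=> v [vw ->]; exists v.
case: (wl) => wn0 wns; apply/seteqP; split=> x.
- by case=> [[/wn0]//|[[v [vw []]]|[]//]]; move/wns.
- by right; right.
Qed.

End Iteration.

(* Decreasing iterations take intersections at limits, increasing ones take
   unions. [dec_iter step start a] is the stage with index exactly [a]. *)
Definition dec_stage (X : Type) (step : set X -> set X) (start : set X)
    (a : Ord) : a -> set X :=
  stage step (fun F => \bigcap_(A in F) A) start (a := a).

Definition inc_stage (X : Type) (step : set X -> set X) (start : set X)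
    (a : Ord) : a -> set X :=
  stage step (fun F => \bigcup_(A in F) A) start (a := a).

Definition dec_iter (X : Type) (step : set X -> set X) (start : set X)
    (a : Ord) : set X :=
  dec_stage step start (a := osucc a) None.

Definition inc_iter (X : Type) (step : set X -> set X) (start : set X)
    (a : Ord) : set X :=
  inc_stage step start (a := osucc a) None.

Section Restriction.
Variables (X : topologicalType) (A : set X) (f : X -> X).
Hypothesis fA : forall x, A x -> A (f x).

Definition restrict (x : A) : A :=
  exist _ (f (val x)) (mem_set (fA (set_mem (valP x)))).

Lemma restrict_continuous : continuous f -> continuous restrict.
Proof.
move=> cf; apply: (@continuous_comp_initial _ _ _ (set_val : A -> X)).
move=> x; apply: (@continuous_comp (set_type A) X X set_val f); last exact: cf.
exact: initial_continuous.
Qed.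

End Restriction.

Lemma closure_map (X Y : topologicalType) (f : X -> Y) (A : set X) (B : set Y) :
  continuous f -> (forall x, A x -> B (f x)) ->
  forall x, closure A x -> closure B (f x).
Proof.
move=> cf fAB x Ax V /cf /Ax[y [/fAB By Vy]].
by exists (f y).
Qed.

(* Both notions of WAP, for labels and for systems, are instances of this one:
   [F] is the set of the maps by which the acting monoid acts on [X]. *)
Definition wap_action (X : topologicalType) (F : set (X -> X)) :=
  forall p : X -> X, closure (F : set {ptws X -> X}) p -> continuous p.

(* An N-vector is a finite multiset on the index set; the index [l : nat]
   stands for the positive integer [l + 1]. *)
Definition FIN := {mset nat}%mset.

Record label := Label {
  label_set :> set FIN;
  label_down : forall m1 m : FIN,
    label_set m -> (forall l, (m1 l <= m l)%N) -> label_set m1 }.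

Lemma label_eq (M N : label) : label_set M = label_set N -> M = N.
Proof.
case: M N => [A dA] [B dB] /= AB.
by rewrite {A}AB in dA *; rewrite (Prop_irrelevance dA dB).
Qed.

Definition empty_label : label.
Proof. by exists set0. Defined.

Definition zero_label : label.
Proof.
exists [set mset0] => m1 _ -> m10; apply/msetP => l.
by have := m10 l; rewrite mset0E leqn0 => /eqP.
Defined.

(* With the shifted index, supp m \subset [1, N] reads "m l <> 0 -> l < N". *)
Definition label_box (N : nat) : set FIN :=
  [set m | (forall l, (m l < N)%N) /\ (forall l, m l != 0%N -> (l < N)%N)].

Definition agree (M1 M2 : label) (N : nat) :=
  (M1 : set FIN) `&` label_box N = (M2 : set FIN) `&` label_box N.

Definition label_dist (M1 M2 : label) : Rdefinitions.R :=
  inf [set 2 ^- N | N in agree M1 M2].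

Lemma pow_gt0 N : (0 : Rdefinitions.R) < 2 ^- N.
Proof. by rewrite invr_gt0 exprn_gt0. Qed.

Lemma pow_small (e : Rdefinitions.R) : 0 < e -> exists N : nat, 2 ^- N < e.
Proof.
move=> e0; have := upper_nthrootP (leqnn (Num.bound e^-1)).
set N := Num.bound _ => eN; exists N.
by rewrite -[ltRHS]invrK ltf_pV2 ?posrE ?exprn_gt0 ?invr_gt0.
Qed.

Lemma pow_lt N1 N2 : ((2 ^- N1 : Rdefinitions.R) < 2 ^- N2) = (N2 < N1)%N.
Proof. by rewrite ltf_pV2 ?posrE ?exprn_gt0// ltr_eXn2l// ltr1n. Qed.

Section Label_metric.
Implicit Types (M : label) (N : nat).

Lemma label_box_mono N1 N2 : (N1 <= N2)%N -> label_box N1 `<=` label_box N2.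
Proof.
move=> N12 m [m1 m2]; split=> [l|l /m2 lN1]; last exact: leq_trans N12.
exact: leq_trans (m1 l) N12.
Qed.

Lemma label_box_cover (m : FIN) : exists N, label_box N m.
Proof.
exists (\max_(l <- finsupp m) (maxn (m l) l)).+1.
have bnd l : m l != 0%N ->
    (maxn (m l) l <= \max_(l <- finsupp m) (maxn (m l) l))%N.
  by move=> ml; rewrite (bigD1_seq l)//= ?leq_maxl// mem_finsupp.
split=> l.
  have [->//|/bnd] := eqVneq (m l) 0%N.
  by rewrite geq_max => /andP[].
by move/bnd; rewrite geq_max => /andP[].
Qed.

Lemma agree_le M1 M2 N1 N2 : (N1 <= N2)%N -> agree M1 M2 N2 -> agree M1 M2 N1.
Proof.
move=> /label_box_mono N12; rewrite /agree => M12.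
have N21 : label_box N2 `&` label_box N1 = label_box N1.
  by apply/seteqP; split=> [m []//|m m1]; split=> //; exact: N12.
by rewrite -N21 (setIA (M1 : set FIN)) (setIA (M2 : set FIN)) M12.
Qed.

Lemma agree0 M1 M2 : agree M1 M2 0.
Proof.
have b0 : label_box 0 = set0 by apply/seteqP; split=> // m [/(_ 0%N)].
by rewrite /agree b0 !setI0.
Qed.

Lemma agree_trans M2 M1 M3 N : agree M1 M2 N -> agree M2 M3 N -> agree M1 M3 N.
Proof. by rewrite /agree => ->. Qed.

Let S M1 M2 := [set (2 ^- N : Rdefinitions.R) | N in agree M1 M2].

Let S_lb M1 M2 : lbound (S M1 M2) 0.
Proof. by move=> _ [N _ <-]; apply: ltW; exact: pow_gt0. Qed.

Let S_hi M1 M2 : has_inf (S M1 M2).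
Proof.
split; last by exists 0; exact: S_lb.
by exists (2 ^- 0), 0%N => //; exact: agree0.
Qed.

Lemma label_dist_ge0 M1 M2 : 0 <= label_dist M1 M2.
Proof. by apply: lb_le_inf; [have [] := S_hi M1 M2 | exact: S_lb]. Qed.

Lemma label_dist_le M1 M2 N : agree M1 M2 N -> label_dist M1 M2 <= 2 ^- N.
Proof.
by move=> M12; apply: ge_inf; [have [] := S_hi M1 M2 | exists N].
Qed.

Lemma label_dist_lt M1 M2 N : label_dist M1 M2 < 2 ^- N -> agree M1 M2 N.
Proof.
move=> /inf_lt[|_ [n nM <-]]; first by have [] := S_hi M1 M2.
by rewrite pow_lt => /ltnW nN; exact: agree_le nM.
Qed.

Lemma label_dist_eq0 M1 M2 : label_dist M1 M2 = 0 -> M1 = M2.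
Proof.
move=> d0; apply: label_eq; apply/seteqP.
have ag N : agree M1 M2 N by apply: label_dist_lt; rewrite d0 pow_gt0.
split=> m mM; have [N mN] := label_box_cover m.
- suff [] : ((M2 : set FIN) `&` label_box N) m by [].
  by rewrite -ag.
- suff [] : ((M1 : set FIN) `&` label_box N) m by [].
  by rewrite ag.
Qed.

Lemma label_distxx M : label_dist M M = 0.
Proof.
apply/eqP; rewrite eq_le label_dist_ge0 andbT leNgt; apply/negP => d0.
have [N Nd] := pow_small d0.
by have := label_dist_le (erefl : agree M M N); rewrite leNgt Nd.
Qed.

Lemma label_dist_sym M1 M2 : label_dist M1 M2 = label_dist M2 M1.
Proof.
by rewrite /label_dist; congr (inf (_ @` _)); apply/seteqP; split=> N /esym.
Qed.

Lemma label_dist_ultra M2 M1 M3 :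
  label_dist M1 M3 <= Order.max (label_dist M1 M2) (label_dist M2 M3).
Proof.
rewrite leNgt; apply/negP; rewrite gt_max => /andP[].
move=> /inf_lt[|_ [n1 a1 <-] h1]; first by have [] := S_hi M1 M2.
move=> /inf_lt[|_ [n2 a2 <-] h2]; first by have [] := S_hi M2 M3.
have a12 : agree M1 M3 (minn n1 n2).
  apply: (@agree_trans M2).
    by apply: agree_le a1; exact: geq_minl.
  by apply: agree_le a2; exact: geq_minr.
move: (label_dist_le a12); rewrite leNgt /minn.
by case: ifP; rewrite ?h1 ?h2.
Qed.

Lemma label_dist_triangle M2 M1 M3 :
  label_dist M1 M3 <= label_dist M1 M2 + label_dist M2 M3.
Proof.
apply: (le_trans (label_dist_ultra M2 M1 M3)).
by rewrite ge_max lerDl lerDr !label_dist_ge0.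
Qed.

End Label_metric.

HB.instance Definition _ := gen_eqMixin label.
HB.instance Definition _ := gen_choiceMixin label.
HB.instance Definition _ := @isMetric.Build Rdefinitions.R label label_dist
  label_distxx label_dist_eq0 label_dist_sym label_dist_triangle.

(* [shift_label r M] is P_r(M) = M - r. *)
Definition shift_label (r : FIN) (M : label) : label.
Proof.
exists [set w : FIN | (M : set FIN) (w `+` r)%mset] => w1 w /= wM w1w.
by apply: label_down wM _ => l; rewrite !msetE2 leq_add2r.
Defined.

Lemma shift_label_continuous r : continuous (shift_label r).
Proof.
move=> M; apply/(@cvg_ballP _ label label (nbhs M)) => e e0; rewrite near_simpl.
have [n ne] := pow_small e0; have [k [rk1 rk2]] := label_box_cover r.
have box_add w : label_box n w -> label_box (n + k) (w `+` r)%mset.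
  move=> [w1 w2]; split=> l; rewrite msetE2.
    by rewrite -addnS leq_add// ltnW.
  have [w0|/w2 ln _] := eqVneq (w l) 0%N; last exact: ltn_addr.
  by rewrite w0 add0n => /rk2 lk; exact: ltn_addl.
apply: filterS (nbhsx_ballx M (2 ^- (n + k)) (pow_gt0 _)) => N.
rewrite !ballEmdist /= => /label_dist_lt MN.
apply: le_lt_trans ne; apply: label_dist_le.
have MNw w : label_box n w ->
    (M : set FIN) (w `+` r)%mset <-> (N : set FIN) (w `+` r)%mset.
  move=> /box_add wr; split=> h.
  - suff [] : ((N : set FIN) `&` label_box (n + k)) (w `+` r)%mset by [].
    by rewrite -MN.
  - suff [] : ((M : set FIN) `&` label_box (n + k)) (w `+` r)%mset by [].
    by rewrite MN.
by apply/seteqP; split=> w [/= h wn]; split=> //=; apply/(MNw _ wn).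
Qed.

Definition Theta (M : label) : set label :=
  closure [set shift_label r M | r in [set: FIN]].

Definition Theta' (M : label) : set label :=
  closure [set shift_label r M | r in [set r | r != mset0]].

Lemma Theta_invariant M r N : Theta M N -> Theta M (shift_label r N).
Proof.
apply: closure_map; first exact: shift_label_continuous.
move=> _ [s _ <-]; exists (r `+` s)%mset => //; apply: label_eq.
by apply/seteqP; split=> w /=; rewrite msetDA.
Qed.

Definition simple_label (M : label) :=
  Theta M = [set shift_label r M | r in [set: FIN]].

Definition finitary_label (M : label) :=
  (forall l, exists B, forall m : FIN, (M : set FIN) m -> (m l <= B)%N) /\
  (forall r : nat -> FIN,
     infinite_set (\bigcup_i [set l | r i l != 0%N]) ->
     finite_set (\bigcup_i \bigcap_(j in [set j | (i <= j)%N])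
                   (shift_label (r j) M : set FIN))).

Definition wap_label (M : label) :=
  wap_action [set restrict (@Theta_invariant M r) | r in [set: FIN]].

Definition zLAB (Phi : set label) : set label :=
  closure (\bigcup_(r in [set r | r != mset0]) (shift_label r @` Phi)).

Definition zLAB_star (M : label) (Phi : set label) : set label :=
  [set N | Theta M N /\ Theta' N `<=` Phi].

(* "The height of [M] is a + 1", including that [M] is in the domain where the
   height is defined; at most one ordinal [a] satisfies the equation. *)
Definition label_height_succ (M : label) (a : Ord) :=
  [/\ M <> empty_label, wap_label M &
      dec_iter zLAB (Theta M) a = [set empty_label; zero_label]].

(* "The height* of [M] is a + 1". *)
Definition label_height_star_succ (M : label) (a : Ord) :=
  [/\ M <> empty_label, wap_label M &
      inc_iter (zLAB_star M) [set empty_label] a = Theta' M].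

Record homeo (X : topologicalType) := Homeo {
  hmap :> X -> X;
  hinv : X -> X;
  hmapK : cancel hmap hinv;
  hinvK : cancel hinv hmap;
  hmap_continuous : continuous hmap;
  hinv_continuous : continuous hinv }.

Section Systems.
Variables (X : topologicalType) (T : homeo X).

Definition hpow (n : int) : X -> X :=
  match n with
  | Posz k => iter k T
  | Negz k => iter k.+1 (hinv T)
  end.

Lemma hpow_succ (n : int) (x : X) : hpow (n + 1) x = T (hpow n x).
Proof.
case: n => [n|[|n]].
- by have -> : Posz n + 1 = n.+1 by lia.
- by rewrite /= hinvK.
- have -> : Negz n.+1 + 1 = Negz n by lia.
  by rewrite /= hinvK.
Qed.

Lemma hpow_pred (n : int) (x : X) : hpow (n - 1) x = hinv T (hpow n x).
Proof. by rewrite -[in RHS](subrK 1 n) hpow_succ hmapK. Qed.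

Definition transitive_system :=
  forall U V : set X, open U -> open V -> U !=set0 -> V !=set0 ->
  exists n : int, (hpow n @^-1` U) `&` V !=set0.

Definition wap_system := wap_action (range hpow).

Definition limit_points (x : X) : set X :=
  cluster ((fun k : nat => hpow k%:Z x) @ \oo) `|`
  cluster ((fun k : nat => hpow (- k%:Z) x) @ \oo).

Definition zLIM (Y : set X) : set X :=
  closure (\bigcup_(x in Y) limit_points x).

(* [Some g] ranges over the ordinals smaller than [b], and [None] is [b]. *)
Definition system_height (b : Ord) :=
  let z := dec_stage zLIM [set: X] (a := osucc b) in
  z None = zLIM (z None) /\ forall g : b, z (Some g) <> zLIM (z (Some g)).

Definition zLIM_star (Y : set X) : set X := [set x | limit_points x `<=` Y].

(* The first three conditions are the domain where height* is defined: a WAP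
   system whose only recurrent point is the fixed point [e]. *)
Definition system_height_star (e : X) (b : Ord) :=
  let z := inc_stage zLIM_star [set e] (a := osucc b) in
  [/\ wap_system, T e = e, [set x | limit_points x x] = [set e] &
      z None = [set: X] /\ forall g : b, z (Some g) <> [set: X]].

Definition orbit_closure (x : X) : set X :=
  closure (range (fun n : int => hpow n x)).

End Systems.

Section Subsystem.
Variables (X : topologicalType) (T : homeo X) (x : X).

Lemma orbit_closure_map y : orbit_closure T x y -> orbit_closure T x (T y).
Proof.
apply: closure_map; first exact: hmap_continuous.
by move=> _ [n _ <-]; exists (n + 1) => //; exact: hpow_succ.
Qed.

Lemma orbit_closure_inv y :
  orbit_closure T x y -> orbit_closure T x (hinv T y).
Proof.
apply: closure_map; first exact: hinv_continuous.
by move=> _ [n _ <-]; exists (n - 1) => //; exact: hpow_pred.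
Qed.

Lemma orbit_restrictK :
  cancel (restrict orbit_closure_map) (restrict orbit_closure_inv).
Proof. by move=> y; apply: val_inj => /=; exact: hmapK. Qed.

Lemma orbit_restrict_invK :
  cancel (restrict orbit_closure_inv) (restrict orbit_closure_map).
Proof. by move=> y; apply: val_inj => /=; exact: hinvK. Qed.

Definition orbit_system : homeo (orbit_closure T x) :=
  Homeo orbit_restrictK orbit_restrict_invK
    (@restrict_continuous _ _ _ orbit_closure_map (@hmap_continuous _ T))
    (@restrict_continuous _ _ _ orbit_closure_inv (@hinv_continuous _ T)).

End Subsystem.

Definition bseq := {ptws int -> bool}.

Definition shift_by (c : int) (x : bseq) : bseq := fun t => x (t + c).

Lemma shift_byK c : cancel (shift_by c) (shift_by (- c)).
Proof. by move=> x; apply: funext => t; rewrite /shift_by addrNK. Qed.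

Lemma shift_byNK c : cancel (shift_by (- c)) (shift_by c).
Proof. by move=> x; apply: funext => t; rewrite /shift_by addrK. Qed.

Lemma shift_by_continuous c : continuous (shift_by c).
Proof.
move=> x; apply/cvg_sup => t.
pose pr := fun y : int -> bool => y t.
apply: (@continuous_comp_initial _ bseq _ pr (shift_by c)) => y.
exact: (@proj_continuous int (fun=> bool) (t + c) y).
Qed.

Definition shift : homeo bseq :=
  Homeo (shift_byK 1) (@shift_byNK 1)
    (@shift_by_continuous 1) (@shift_by_continuous (- 1)).

Definition char_seq (A : set int) : bseq := fun t => `[< A t >].

Definition subshift (A : set int) : topologicalType :=
  orbit_closure shift (char_seq A).

Definition subshift_map (A : set int) : homeo (subshift A) :=
  orbit_system shift (char_seq A).

Definition is_least (A : set nat) (m : nat) :=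
  A m /\ forall n, A n -> (m <= n)%N.

(* [D l] is D_(l+1): only the index of the partition is shifted, its blocks
   consist of positive integers. *)
Definition is_index_partition (D : nat -> set nat) :=
  [/\ partition [set: nat] D [set n | (0 < n)%N],
      forall l, infinite_set (D l) &
      forall l m m', is_least (D l) m -> is_least (D l.+1) m' -> (m < m')%N].

Section Expanding.
Variables (b : nat) (D : nat -> set nat).

Definition kfun (n : int) : int := Num.sg n * b%:Z ^+ (`|n|%N.-1).

(* The sums of the finite subsets of k(J); the empty sum is 0. *)
Definition IP_of (J : set int) : set int :=
  [set t | exists2 F : {fset int}, [set` F] `<=` kfun @` J &
                                   t = \sum_(u <- F) u].

Definition IP : set int := IP_of [set: int].
Definition IP_plus : set int := IP_of [set j | 0 <= j].

Definition is_expansion (t : int) (js : seq int) :=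
  [/\ sorted (fun i j : int => (`|j| < `|i|)%N) js, 0 \notin js &
      t = \sum_(j <- js) kfun j].

(* r(t) = m; the expansion of t, hence m, is unique. *)
Definition length_vector (t : int) (m : FIN) :=
  exists2 js, is_expansion t js &
    forall l, m l = count (fun j : int => `[< D l `|j|%N >]) js.

Definition label_times (M : label) : set int :=
  IP `&` [set t | exists2 m : FIN, length_vector t m & (M : set FIN) m].

Definition label_times_plus (M : label) : set int := label_times M `&` IP_plus.

End Expanding.

(* Main.v *)
Require Import Defs.
Set Warnings "-notation-incompatible-prefix,-notation-overridden,-ambiguous-paths,-redundant-canonical-projection".
From mathcomp Require Import all_boot all_order all_algebra finmap multiset.
From mathcomp Require Import zify.
From mathcomp Require Import all_classical topology.

(** Given a countable ordinal [a], consider the tree whose nodes are the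
    finite strictly descending sequences of ordinals below [a], code its nodes
    by numbers, and let the label consist of the finite sets of pairwise
    comparable nodes, that is, of the vectors below some branch
    ([chain_label]). The tree is well founded, so a sequence of such sets
    either is constant along an ultrafilter or scatters below a node [s], and
    then the limit of the translates is a finite label, made of sets on the
    branch of [s] ([ulim_chain_label]). This limit is again a translate, since
    below [s] there is a leaf; hence the label is simple and finitary.

    Its heights are read off from the entries of the nodes. A nonzero vector
    [q] on the branch of a node reaches the entry whose position is the size
    of [q], and larger vectors reach smaller entries. Under the decreasing
    iteration a label that contains [q] cannot survive beyond that entry
    ([stage_entry]), while the label of all sets on the branch of [s] survives
    until the last entry of [s], because it is what remains of the longer
    branches when their last node is removed ([stage_below]); at the root this
    says that the zero label survives exactly to the end. In the increasing
    iteration the translate by [q] appears right after the entry of [q]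
    ([star_stage_entry]), and the translate by a whole branch not before
    ([star_stage_branch]), so the label itself comes last.

    For the subshifts, let the label [M] be simple and without infinite
    chains, which finitary labels are ([finitary_chainless]). The analysis
    rests on the uniqueness of signed expansions: adding an expansion [h] with
    large indices to the integers of a window changes the set of a label into
    the set of its translate by the vector of [h] ([lset_high]). Along an
    ultrafilter, a family of translations whose limit is not zero splits into
    a constant and such an [h]; the indices that persist are finitely many,
    for otherwise they would produce an infinite chain of vectors
    ([lset_ultra]). So the subshift consists of the translates of the
    sequences of the labels in [Theta M], the limit points of the sequence of
    [N] come from the labels in [Theta' N] ([limit_points_lseq]), and
    different labels give different orbits ([lset_inj]). Both iterations of
    the system are therefore the images of the label iterations, continued by
    one step, in which the zero label disappears from the decreasing iteration
    and [M] joins the increasing one. Finally a limit of powers of the shift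
    is one translation combined with one translation of labels, and such a map
    is continuous ([label_wap]). *)

Set Implicit Arguments.
Unset Strict Implicit.
Unset Printing Implicit Defensive.

Import Order.TTheory GRing.Theory Num.Theory.

Local Open Scope classical_set_scope.

(** * Ultrafilters *)

Lemma filter_finite (I : Type) (U : set_system I) {FU : Filter U}
    (T : Type) (D : set T) (P : T -> set I) :
  finite_set D -> (forall x, D x -> U (P x)) ->
  U [set i | forall x, D x -> P x i].
Proof.
move=> fD; have [X ->] := iffLR (@finite_fsetP {classic T} D) fD.
move=> h; have := @filter_bigI _ {classic T} X P U FU h.
by apply: filterS => i hi x /hi.
Qed.

Section Ultrafilters.
Variables (I : Type) (U : set_system I).
Hypothesis UU : UltraFilter U.

Lemma ultra_notin (A : set I) : ~ U A -> U (~` A).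
Proof. by have [//|] := in_ultra_setVsetC A UU. Qed.

Lemma ultra_absurd (A : set I) : U A -> ~ U (~` A).
Proof. by move=> h1 h2; have [x []] := filter_ex (filterI h1 h2). Qed.

Lemma ultra_decide (A : set I) (P : Prop) :
  (U A -> P) -> (P -> U A) -> U [set i | A i <-> P].
Proof.
move=> h1 h2; have [UA|/ultra_notin UA] := pselect (U A).
  by apply: filterS (UA) => i Ai; split => // _; exact: h1.
apply: filterS (UA) => i nAi; split => // p.
by case: (ultra_absurd (h2 p) UA).
Qed.

Lemma ultra_pigeon (T : Type) (D : set T) (f : I -> T) :
  finite_set D -> U [set i | D (f i)] -> exists2 x, D x & U [set i | f i = x].
Proof.
move=> fD h; apply: contrapT => nx.
have := filter_finite (U := U) (P := fun x => [set i | f i <> x]) fD.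
move=> H; have {}nx x : D x -> U [set i | f i <> x].
  by move=> Dx; apply: ultra_notin => hx; apply: nx; exists x.
by have [i [/= Di /(_ _ Di)]] := filter_ex (filterI h (H _ nx)).
Qed.

End Ultrafilters.

(** Points of a closure are limits along ultrafilters. In the spaces of labels,
    of sequences and of their self-maps the topology is pointwise, so such a
    limit is a family of yes-no questions, all of which the ultrafilter
    decides. *)
Lemma closure_ultra (T : topologicalType) (A : set T) (p : T) :
  closure A p ->
  exists U : set_system T, [/\ UltraFilter U, U A & nbhs p `<=` U].
Proof.
move=> Ap; have PF : ProperFilter (within A (nbhs p)).
  apply: Build_ProperFilter_ex => B; rewrite /within /= => nB.
  by have [x [Ax /= Bx]] := Ap _ nB; exists x; exact: Bx.
have [U [UU sU]] := ultraFilterLemma PF.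
exists U; split => //; first by apply: sU; exact: withinT.
by move=> B nB; apply: sU; rewrite /within /=; apply: filterS nB.
Qed.

(** * Limits of labels *)

Lemma finite_label_box n : finite_set (label_box n).
Proof.
pose enc (m : FIN) : {ffun 'I_n -> 'I_n.+1} := [ffun i : 'I_n => inord (m i)].
have enc_inj : {in label_box n &, injective enc}.
  move=> m m' /set_mem[m1 m2] /set_mem[m1' m2'] /ffunP mm'; apply/msetP => l.
  have [ln|nl] := ltnP l n; last first.
    suff h (q : FIN) : (forall l, q l != 0%N -> (l < n)%N) -> q l = 0%N.
      by rewrite !h.
    by move=> h; apply/eqP; apply: contraTT nl => /h; rewrite ltnNge.
  have := mm' (Ordinal ln); rewrite !ffunE /= => /(congr1 val).
  by rewrite /= !inordK // ltnW // ltnS.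
have /card_eqPle[_ le] := inj_card_eq enc_inj.
exact: card_le_finite le finite_finset.
Qed.

(** The boxes exhaust the vectors, so convergence of labels is convergence of
    membership, one vector at a time. *)
Lemma nbhs_label_mem (N : label) (m : FIN) :
  nbhs N [set N' : label | (N' : set FIN) m <-> (N : set FIN) m].
Proof.
have [n mn] := label_box_cover m.
apply: filterS (nbhsx_ballx N _ (pow_gt0 n)) => N'.
rewrite ballEmdist /= => /label_dist_lt NN'; split => h.
- suff [] : ((N : set FIN) `&` label_box n) m by [].
  by rewrite NN'.
- suff [] : ((N' : set FIN) `&` label_box n) m by [].
  by rewrite -NN'.
Qed.

Lemma nbhs_agree (N : label) (B : set label) :
  nbhs N B -> exists n, forall N', agree N N' n -> B N'.
Proof.
move=> /nbhs_ballP[e /= e0 eB]; have [n ne] := pow_small e0.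
exists n => N' NN'; apply: eB; rewrite ballEmdist /=.
exact: le_lt_trans (label_dist_le NN') ne.
Qed.

Section Ulim.
Variables (I : Type) (U : set_system I).
Hypothesis UU : UltraFilter U.

(** Every family has such a limit; this is how the compactness of the space of
    labels is used. *)
Definition ulim (N : I -> label) : label.
Proof.
exists [set m : FIN | U [set i | (N i : set FIN) m]] => m1 m Um m1m /=.
by apply: filterS Um => i /= /label_down; exact.
Defined.

Lemma ulim_agree (N : I -> label) n : U [set i | agree (ulim N) (N i) n].
Proof.
have := filter_finite (U := U)
  (P := fun m => [set i | (N i : set FIN) m <-> (ulim N : set FIN) m])
  (finite_label_box n).
move=> /(_ _ _)/filterS; apply.
  by move=> i h; apply/seteqP; split => m [] mN mn; split => //; apply/(h m mn).
by move=> m _; exact: ultra_decide.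
Qed.

Lemma ulim_closure (P : set label) (N : I -> label) :
  U [set i | P (N i)] -> closure P (ulim N).
Proof.
move=> UP B /nbhs_agree[n nB].
have [i [/= Pi ai]] := filter_ex (filterI UP (ulim_agree N n)).
by exists (N i); split => //; exact: nB.
Qed.

Lemma ulim_const (N : I -> label) (N0 : label) :
  U [set i | N i = N0] -> ulim N = N0.
Proof.
move=> h; apply: label_eq; apply/seteqP; split => m /=.
- by move=> hm; have [i [/= <-]] := filter_ex (filterI h hm).
- by move=> hm; apply: filterS h => i /= ->.
Qed.

Lemma ulim_shift (N : I -> label) r :
  ulim (fun i => shift_label r (N i)) = shift_label r (ulim N).
Proof. exact: label_eq. Qed.

End Ulim.

Lemma closure_ulim (P : set label) (N : label) : closure P N ->
  exists U : set_system label,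
  exists UU : UltraFilter U, U P /\ ulim UU id = N.
Proof.
move=> /closure_ultra[U [UU UP sU]]; exists U, UU; split => //.
apply: label_eq; apply/seteqP; split => m /=.
- move=> h; have /sU h' := nbhs_label_mem N m.
  by have [N' [/= N'm <-]] := filter_ex (filterI h h').
- by move=> h; apply: filterS (sU _ (nbhs_label_mem N m)) => N' /= ->.
Qed.

(** * Labels without infinite chains *)

Definition fle (m m' : FIN) := forall l, (m l <= m' l)%N.

Lemma fle_trans m2 m1 m3 : fle m1 m2 -> fle m2 m3 -> fle m1 m3.
Proof. by move=> h1 h2 l; exact: leq_trans (h1 l) (h2 l). Qed.

Lemma fle_anti m1 m2 : fle m1 m2 -> fle m2 m1 -> m1 = m2.
Proof. by move=> h1 h2; apply/msetP => l; apply/eqP; rewrite eqn_leq h1 h2. Qed.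

Lemma fle0 m : fle mset0 m. Proof. by move=> l; rewrite mset0E. Qed.

Lemma fleDl m m' : fle m (m `+` m')%mset.
Proof. by move=> l; rewrite msetE2 leq_addr. Qed.

Lemma fleDr m m' : fle m (m' `+` m)%mset.
Proof. by move=> l; rewrite msetE2 leq_addl. Qed.

Lemma mset_neq0_ex (m : FIN) : m <> mset0 <-> exists l, m l != 0%N.
Proof.
split=> [m0|[l ml] m0]; last by rewrite m0 mset0E in ml.
apply: contrapT => h; apply: m0; apply/msetP => l; rewrite mset0E.
by apply/eqP; apply/negPn/negP => ml; apply: h; exists l.
Qed.

Lemma msetD_eq (m r : FIN) : m = (m `+` r)%mset -> r = mset0.
Proof.
move=> /msetP h; apply/msetP => l; have := h l; rewrite msetE2 mset0E; lia.
Qed.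

Lemma fle_subK (m m' : FIN) : fle m m' -> (m `+` (m' `\` m))%mset = m'.
Proof. by move=> h; apply/msetP => l; rewrite !msetE2 subnKC. Qed.

Definition chain (f : nat -> FIN) := forall n, fle (f n) (f n.+1) /\ f n <> f n.+1.

Lemma chain_mono f : chain f -> forall i j, (i <= j)%N -> fle (f i) (f j).
Proof.
move=> cf i; elim=> [|j IH]; first by rewrite leqn0 => /eqP ->.
rewrite leq_eqVlt => /orP[/eqP -> //|/IH h].
by apply: fle_trans h _; case: (cf j).
Qed.

Lemma chain_inj f : chain f -> injective f.
Proof.
move=> cf; suff h i j : (i < j)%N -> f i <> f j.
  move=> i j fij; have [/h|/h|//] := ltngtP i j; by [|move/(_ (esym fij))].
move=> ij fij; case: (cf i) => h; apply; apply: fle_anti => //.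
by rewrite fij; exact: chain_mono.
Qed.

(** Finitary labels have this property. It provides maximal vectors, excludes
    recurrence, and keeps the limits of expansions finite. *)
Definition chainless (M : label) :=
  forall f, chain f -> ~ forall n, (M : set FIN) (f n).

Lemma inj_infinite (T : Type) (f : nat -> T) (A : set T) :
  injective f -> (forall n, A (f n)) -> infinite_set A.
Proof.
move=> fi fA fin.
have h : finite_set (range f).
  by apply: sub_finite_set fin => _ [n _ <-]; exact: fA.
have /card_eqPle[_ le] : (range f #= [set: nat])%card by apply: inj_card_eq; exact: in2W.
exact: infinite_nat (card_le_finite le h).
Qed.

Lemma infinite_enum (T : Type) (A : set T) : infinite_set A ->
  exists2 f : nat -> T, injective f & forall n, A (f n).
Proof.
elim/Ppointed: T => T in A *.
  by rewrite emptyE.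
move=> /infiniteP/ppcard_leP[f]; exists f => [x y|n]; last exact: funS.
by apply: inj; rewrite inE.
Qed.

(** The even and the odd increments of an infinite chain make up two chains.
    Translating by a vector of the first leaves room for all of the second,
    which the second clause of finitariness forbids; the first clause keeps the
    supports of the first chain from staying in one finite set. *)
Lemma finitary_chainless M : finitary_label M -> chainless M.
Proof.
move=> [Mb Mf] f cf fM.
pose d n : FIN := (f n.+1 `\` f n)%mset.
have dE n : (f n `+` d n)%mset = f n.+1 by apply: fle_subK; case: (cf n).
have d0 n : d n <> mset0.
  by move=> dn; case: (cf n) => _; apply; rewrite -[RHS]dE dn msetD0.
pose part (e : nat) n : FIN := iteri n (fun k q => (q `+` d (k.*2 + e)%N)%mset) mset0.
have partS e n : part e n.+1 = (part e n `+` d (n.*2 + e)%N)%mset by [].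
have part_chain e : chain (part e).
  move=> n; split; first exact: fleDl.
  by move=> /= /msetD_eq /d0.
have partE n : fle (part 0%N n `+` part 1%N n)%mset (f n.*2).
  elim: n => [|n IH] l; first by rewrite !msetE2 /= !mset0E.
  have := IH l; rewrite doubleS -!dE !partS !msetE2 addn0 addn1; lia.
have partM i j : (M : set FIN) (part 1%N i `+` part 0%N j)%mset.
  apply: label_down (fM (maxn i j).*2) _ => l.
  apply: leq_trans (partE (maxn i j) l); rewrite !msetE2 addnC.
  by apply: leq_add; apply: chain_mono => //; rewrite ?leq_maxl ?leq_maxr.
apply: (inj_infinite (chain_inj (part_chain 1%N)) _ (Mf (part 0%N) _)).
- by move=> i; exists 0%N => // j _ /=; exact: partM.
- set S := (X in infinite_set X) => finS.
  have [B hB] := choice Mb.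
  have [X SX] := iffLR finite_fsetP finS.
  pose N := (\max_(l <- X) maxn l (B l)).+1.
  have bnd l : S l -> (l < N)%N && (B l < N)%N.
    rewrite SX /= => lX; rewrite !ltnS -geq_max.
    by rewrite (big_rem l) //= leq_maxl.
  have inS n l : part 0%N n l != 0%N -> S l by move=> h; exists n.
  apply: (inj_infinite (chain_inj (part_chain 0%N)) _ (finite_label_box N)) => n.
  have pM : (M : set FIN) (part 0%N n).
    by apply: label_down (partM 0%N n) _; exact: fleDr.
  split=> l.
  + have [->//|/inS/bnd/andP[_]] := eqVneq (part 0%N n l) 0%N.
    exact: leq_ltn_trans (hB _ _ pM).
  + by move=> /inS/bnd/andP[].
Qed.

Lemma label_neq0 (M : label) : M <> empty_label <-> (M : set FIN) mset0.
Proof.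
split=> [h|h M0]; last by rewrite M0 in h.
apply: contrapT => h0; apply: h; apply: label_eq; apply/seteqP; split => // m mM.
by apply: h0; apply: label_down mM _; exact: fle0.
Qed.

(** Otherwise every vector of [M] could be enlarged within [M], forever. *)
Lemma chainless_max M : chainless M -> (M : set FIN) mset0 ->
  exists q, (M : set FIN) q /\ forall r, r <> mset0 -> ~ (M : set FIN) (q `+` r)%mset.
Proof.
move=> fM M0; apply: contrapT => nmax.
have ext q : exists r, (M : set FIN) q -> r <> mset0 /\ (M : set FIN) (q `+` r)%mset.
  have [qM|nq] := pselect ((M : set FIN) q); last by exists mset0.
  apply: contrapT => nr; apply: nmax; exists q; split => // r r0 qr.
  by apply: nr; exists r.
have [g gP] := choice ext.
pose f n : FIN := iter n (fun q => (q `+` g q)%mset) mset0.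
have fM' n : (M : set FIN) (f n) by elim: n => [//|n /gP[]].
apply: (fM f) => // n; split; first exact: fleDl.
by move=> /= /msetD_eq; case: (gP _ (fM' n)).
Qed.

Lemma chainless_sub (M N : label) :
  chainless M -> (N : set FIN) `<=` (M : set FIN) -> chainless N.
Proof. by move=> fM NM f cf fN; apply: (fM f cf) => n; exact: NM. Qed.

(** * Translates of a simple label *)

Lemma shift_labelE r (M : label) w :
  (shift_label r M : set FIN) w = (M : set FIN) (w `+` r)%mset.
Proof. by []. Qed.

Lemma shift_labelD r s M :
  shift_label r (shift_label s M) = shift_label (s `+` r)%mset M.
Proof.
apply: label_eq; apply/seteqP.
by split => w /=; rewrite -msetDA (msetDC r s).
Qed.

Lemma shift_label0 M : shift_label mset0 M = M.
Proof. by apply: label_eq; apply/seteqP; split => w /=; rewrite msetD0. Qed.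

Lemma shift_label_empty r : shift_label r empty_label = empty_label.
Proof. exact: label_eq. Qed.

Lemma shift_label_sub r (M : label) :
  (shift_label r M : set FIN) `<=` (M : set FIN).
Proof. by move=> w /= /label_down; apply; exact: fleDl. Qed.

Lemma shift_label_notin r (M : label) :
  ~ (M : set FIN) r -> shift_label r M = empty_label.
Proof.
move=> rM; apply: contrapT => /label_neq0 /=; rewrite mset0D; exact: rM.
Qed.

Lemma zero_labelE (M : label) : (M : set FIN) `<=` [set mset0] ->
  M = empty_label \/ M = zero_label.
Proof.
move=> M0; have [->|/label_neq0 h] := pselect (M = empty_label); [by left|right].
by apply: label_eq; apply/seteqP; split => // m ->.
Qed.

Lemma shift_zero_label r : r <> mset0 -> shift_label r zero_label = empty_label.
Proof. by move=> r0; apply: shift_label_notin. Qed.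

Lemma closure_shift_ulim (N N' : label) (D : set FIN) :
  closure [set shift_label r N | r in D] N' ->
  exists (U : set_system label) (UU : UltraFilter U) (r : label -> FIN),
    U [set i | D (r i)] /\ N' = ulim UU (fun i => shift_label (r i) N).
Proof.
move=> /closure_ulim[U [UU [UD <-]]]; exists U, UU.
have ex L : exists r, [set shift_label r N | r in D] L -> D r /\ shift_label r N = L.
  have [[r Dr rL]|nL] := pselect ([set shift_label r N | r in D] L).
    by exists r.
  by exists mset0.
have [r rP] := choice ex; exists r; split.
  by apply: filterS UD => L /rP[].
apply: label_eq; apply/seteqP; split => m /= h.
- by apply: filterS (filterI h UD) => L [/= Lm /rP[_ rL]]; rewrite -rL in Lm.
- apply: filterS (filterI h UD) => L [/= Lm /rP[_ rL]].
  by rewrite -rL.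
Qed.

Section Simple.
Variable M : label.
Hypotheses (sM : simple_label M) (fM : chainless M).

Lemma ThetaP N : Theta M N <-> exists r, N = shift_label r M.
Proof.
by rewrite sM; split=> [[r _ <-]|[r ->]]; exists r.
Qed.

Lemma Theta_self : Theta M M.
Proof. by apply/ThetaP; exists mset0; rewrite shift_label0. Qed.

Lemma Theta_sub N : Theta M N -> (N : set FIN) `<=` (M : set FIN).
Proof. by move=> /ThetaP[r ->]; exact: shift_label_sub. Qed.

Lemma Theta_shift r N : Theta M N -> Theta M (shift_label r N).
Proof. exact: Theta_invariant. Qed.

(** A limit of shifts is determined by what it does to [M], so it acts on the
    whole of [Theta M] as one shift. *)
Lemma ulim_shift_simple (I : Type) (U : set_system I) (UU : UltraFilter U)
    (r : I -> FIN) :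
  exists G, forall N, Theta M N ->
    ulim UU (fun i => shift_label (r i) N) = shift_label G N.
Proof.
have [G GE] : exists G, ulim UU (fun i => shift_label (r i) M) = shift_label G M.
  apply/ThetaP; apply: ulim_closure; apply: filterE => i /=; exists (r i) => //.
exists G => N /ThetaP[s ->].
rewrite shift_labelD msetDC -shift_labelD -GE -ulim_shift; congr ulim.
by apply: funext => i; rewrite !shift_labelD msetDC.
Qed.

(** A maximal vector of [N] is lost by every nonzero translate of [N]. *)
Lemma chainless_recurrent N : Theta M N -> Theta' N N -> N = empty_label.
Proof.
move=> TN N'N; apply: contrapT => /label_neq0 N0.
have [q [qN qmax]] := chainless_max (chainless_sub fM (Theta_sub TN)) N0.
have [_ [[r /eqP r0 <-] /= h]] := N'N _ (nbhs_label_mem N q).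
exact: qmax r0 (h.2 qN).
Qed.

Lemma empty_shift (N : label) : chainless N -> exists2 r, r <> mset0 & shift_label r N = empty_label.
Proof.
move=> fN; pose f n : FIN := msetn n.+1 0%N.
have cf : chain f.
  move=> n; split=> [l|/msetP/(_ 0%N)]; rewrite !msetnE; last by rewrite eqxx; lia.
  by case: ifP.
have [n nN] : exists n, ~ (N : set FIN) (f n).
  by apply: contrapT => h; apply: (fN f cf) => n; apply: contrapT => h'; apply: h; exists n.
exists (f n); last exact: shift_label_notin.
by apply/mset_neq0_ex; exists 0%N; rewrite msetnE.
Qed.

(** A limit of translates by nonzero vectors is a single translate because [M]
    is simple; the vector is not zero because [N] is not recurrent, unless [N]
    is empty and every vector will do. *)
Lemma Theta'_simple N : Theta M N ->
  Theta' N = [set shift_label r N | r in [set r | r != mset0]].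
Proof.
move=> TN; apply/seteqP; split; last exact: subset_closure.
move=> N' TN'; have := TN' => /closure_shift_ulim[U [UU [r [rD N'E]]]].
have [G GE] := ulim_shift_simple UU r.
have [G0|G0] := eqVneq G mset0; last by exists G => //; rewrite N'E GE.
have NN' : N' = N by rewrite N'E GE // G0 shift_label0.
rewrite NN' in TN' *; have N0 := chainless_recurrent TN TN'.
have [s /eqP s0 _] := empty_shift fM.
by exists s => //; rewrite N0 shift_label_empty.
Qed.

Lemma Theta'_sub N : Theta M N -> Theta' N `<=` Theta M.
Proof. by move=> TN; rewrite Theta'_simple // => _ [r _ <-]; exact: Theta_shift. Qed.

Lemma Theta'_empty N : Theta M N -> Theta' N empty_label.
Proof.
move=> TN; rewrite Theta'_simple //.
have [r /eqP r0 rN] := empty_shift (chainless_sub fM (Theta_sub TN)).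
by exists r.
Qed.

Lemma Theta_empty : Theta M empty_label.
Proof. exact: Theta'_sub Theta_self _ (Theta'_empty Theta_self). Qed.

End Simple.

Lemma nbhs_ptws (X : choiceType) (Y : topologicalType) (p : {ptws X -> Y}) (x : X) (B : set Y) :
  nbhs (p x) B -> nbhs p [set f : {ptws X -> Y} | B (f x)].
Proof. by move=> nB; exact: (@proj_continuous X (fun=> Y) x p). Qed.

Lemma nbhs_set_val (X : topologicalType) (A : set X) (x : A) (B : set X) :
  nbhs (set_val x) B -> nbhs x [set y : A | B (set_val y)].
Proof. by move=> nB; exact: (@initial_continuous A X set_val x). Qed.

(** A pointwise limit of the action on [Theta M] agrees with one translation,
    and translations are continuous. *)
Lemma simple_wap M : simple_label M -> wap_label M.
Proof.
move=> sM p /closure_ultra[U [UU UA sU]].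
have [s hs] : exists s, forall N (TN : Theta M N),
    val (p (exist _ N (mem_set TN))) = shift_label s N.
  have ex f : exists r, [set Defs.restrict (@Theta_invariant M r) | r in [set: FIN]] f ->
      f = Defs.restrict (@Theta_invariant M r).
    have [[r _ rf]|nf] := pselect ([set Defs.restrict (@Theta_invariant M r) | r in [set: FIN]] f).
      by exists r.
    by exists mset0.
  have [r rP] := choice ex; have [G GE] := ulim_shift_simple sM UU r.
  exists G => N TN; rewrite -GE //; apply: label_eq; apply/seteqP.
  pose x : Theta M := exist _ N (mem_set TN).
  have hp m : U [set f : {ptws Theta M -> Theta M} |
      (val (f x) : set FIN) m <-> (val (p x) : set FIN) m].
    apply: sU; apply: (@nbhs_ptws (Theta M) (Theta M) p x
      [set y : Theta M | (val y : set FIN) m <-> (val (p x) : set FIN) m]).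
    exact: (@nbhs_set_val label (Theta M) (p x)
      [set N' : label | (N' : set FIN) m <-> (val (p x) : set FIN) m]
      (nbhs_label_mem _ _)).
  split=> m /= h.
  - apply: filterS (filterI UA (hp m)) => f [/rP fE /= hf].
    by have := hf.2 h; rewrite {1}fE.
  - have [f [[/rP fE /= hf] hm]] := filter_ex (filterI (filterI UA (hp m)) h).
    by apply/hf; rewrite fE.
have -> : p = Defs.restrict (@Theta_invariant M s).
  apply: funext => x; apply: val_inj => /=.
  case: x => N TN; rewrite -(hs N (set_mem TN)); congr (val (p _)).
  exact: val_inj.
exact: restrict_continuous (@shift_label_continuous s).
Qed.

(** * Transfinite stages *)

Section Ordinals.
Variable a : Ord.
Implicit Types u v w : a.

Lemma ord_irr w : ~ ord_lt w w.
Proof. by elim/(well_founded_ind (@ord_wf a)): w => w IH ww; exact: (IH w ww ww). Qed.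

Lemma ord_asym v w : ord_lt v w -> ~ ord_lt w v.
Proof. by move=> vw wv; exact: ord_irr (ord_trans vw wv). Qed.

Definition ord_le v w := v = w \/ ord_lt v w.

Lemma ord_leNgt v w : ord_le v w <-> ~ ord_lt w v.
Proof.
split=> [[->|]|]; [exact: ord_irr|exact: ord_asym|].
by case: (ord_total v w) => [|[|//]]; [right|left].
Qed.

Lemma ord_le_lt_trans u v w : ord_le u v -> ord_lt v w -> ord_lt u w.
Proof. by case=> [->//|]; exact: ord_trans. Qed.

Lemma ord_lt_le_trans u v w : ord_lt u v -> ord_le v w -> ord_lt u w.
Proof. by move=> uv [<-//|]; exact: ord_trans uv. Qed.

Lemma ord_kinds w : [\/ is_zero w, exists v, is_succ_of v w | is_limit w].
Proof.
have [?|w0] := pselect (is_zero w); first by constructor 1.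
have [?|ws] := pselect (exists v, is_succ_of v w); first by constructor 2.
by constructor 3; split => // v vw; apply: ws; exists v.
Qed.

Lemma succ_of_le u v w : is_succ_of v w -> ord_lt u w -> ord_le u v.
Proof. by case=> _ h /h. Qed.

Lemma limit_lt w : is_limit w -> exists v, ord_lt v w.
Proof.
by case=> w0 _; apply: contrapT => nv; apply: w0 => v vw; apply: nv; exists v.
Qed.

Lemma limit_between v w : is_limit w -> ord_lt v w ->
  exists2 u, ord_lt v u & ord_lt u w.
Proof.
case=> _ /(_ v) ns vw; apply: contrapT => nu; apply: ns; split => // u uw.
by apply/ord_leNgt => vu; apply: nu; exists u.
Qed.

Lemma ord_min (P : a -> Prop) : (exists w, P w) ->
  exists w, P w /\ forall v, ord_lt v w -> ~ P v.
Proof.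
move=> [w]; elim/(well_founded_ind (@ord_wf a)): w => w IH Pw.
have [[v vw Pv]|nv] := pselect (exists2 v, ord_lt v w & P v).
  exact: IH vw Pv.
by exists w; split => // v vw Pv; apply: nv; exists v.
Qed.

End Ordinals.

Section Monotone.
Variables (X : Type) (step : set X -> set X) (start : set X) (G : set X -> Prop).
Variable a : Ord.

Lemma dec_stage_mono :
  G start -> (forall A, G A -> G (step A) /\ step A `<=` A) ->
  (forall F : set (set X), F !=set0 -> (forall A, F A -> G A) ->
    G (\bigcap_(A in F) A)) ->
  forall w : a, G (dec_stage step start w) /\
    forall v, ord_lt v w -> dec_stage step start w `<=` dec_stage step start v.
Proof.
move=> G0 GS GL w; elim/(well_founded_ind (@ord_wf a)): w => w IH.
rewrite /dec_stage; case: (ord_kinds w) => [w0|[u uw]|wl].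
- by rewrite stage_zero //; split => // v /w0.
- have [Gu hu] := IH u uw.1; have [GSu Su] := GS _ Gu.
  rewrite (stage_succ _ _ _ uw); split => // v /(succ_of_le uw)[->//|/hu vu].
  exact: subset_trans Su vu.
- rewrite stage_limit //; split=> [|v vw].
    have [v vw] := limit_lt wl.
    apply: GL; first by exists (dec_stage step start v), v.
    by move=> _ [u uw <-]; case: (IH u uw).
  by apply: bigcap_inf; exists v.
Qed.

Lemma inc_stage_mono :
  G start -> (forall A, G A -> G (step A) /\ A `<=` step A) ->
  (forall F : set (set X), F !=set0 -> (forall A, F A -> G A) ->
    G (\bigcup_(A in F) A)) ->
  forall w : a, G (inc_stage step start w) /\
    forall v, ord_lt v w -> inc_stage step start v `<=` inc_stage step start w.
Proof.
move=> G0 GS GL w; elim/(well_founded_ind (@ord_wf a)): w => w IH.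
rewrite /inc_stage; case: (ord_kinds w) => [w0|[u uw]|wl].
- by rewrite stage_zero //; split => // v /w0.
- have [Gu hu] := IH u uw.1; have [GSu Su] := GS _ Gu.
  rewrite (stage_succ _ _ _ uw); split => // v /(succ_of_le uw)[->//|/hu vu].
  exact: subset_trans vu Su.
- rewrite stage_limit //; split=> [|v vw].
    have [v vw] := limit_lt wl.
    apply: GL; first by exists (inc_stage step start v), v.
    by move=> _ [u uw <-]; case: (IH u uw).
  by move=> x vx; exists (inc_stage step start v) => //; exists v.
Qed.

End Monotone.

(** The stages below the height are told apart through this: if the sequence
    stopped early, its last two stages would coincide. *)
Lemma dec_stage_fixed (X : Type) (step : set X -> set X) (start : set X)
    (a : Ord) (w0 : a) :
  (forall v w : a, ord_lt v w ->
    dec_stage step start w `<=` dec_stage step start v) ->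
  step (dec_stage step start w0) = dec_stage step start w0 ->
  forall w, ord_le w0 w -> dec_stage step start w = dec_stage step start w0.
Proof.
move=> mono fx w; elim/(well_founded_ind (@ord_wf a)): w => w IH [<-//|w0w].
case: (ord_kinds w) => [/(_ _ w0w)//|[u uw]|wl].
  have wu := succ_of_le uw w0w.
  by rewrite /dec_stage (stage_succ _ _ _ uw) -!/(dec_stage _ _ _) IH //; case: uw.
apply/seteqP; split; first exact: mono.
rewrite {2}/dec_stage stage_limit // => x x0 _ [u uw <-].
have [w0u|w0u] := pselect (ord_le w0 u).
  by have := IH u uw w0u; rewrite /dec_stage => ->.
by apply: (mono u w0) x0; apply: contrapT => /ord_leNgt.
Qed.

Section Successor.
Variables (X : Type) (step : set X -> set X) (lim : set (set X) -> set X).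
Variables (start : set X) (a : Ord).

Lemma is_zero_Some (w : a) : is_zero (Some w : osucc a) <-> is_zero w.
Proof.
by split=> [h v vw|h [v|//] vw]; [exact: (h (Some v))|exact: h vw].
Qed.

Lemma is_succ_Some (v w : a) :
  is_succ_of (Some v : osucc a) (Some w) <-> is_succ_of v w.
Proof.
split=> -[vw h]; split => //.
- by move=> u uw; case: (h (Some u) uw) => [[->]|]; [left|right].
- by move=> [u|//] uw; case: (h u uw) => [->|]; [left|right].
Qed.

Lemma is_limit_Some (w : a) : is_limit (Some w : osucc a) <-> is_limit w.
Proof.
split=> -[h1 h2]; split=> [/is_zero_Some //|].
  by move=> v /is_succ_Some /h2.
by move=> [v /is_succ_Some /h2|[]].
Qed.

Lemma stage_Some (w : a) :
  stage step lim start (a := osucc a) (Some w) = stage step lim start w.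
Proof.
elim/(well_founded_ind (@ord_wf a)): w => w IH.
case: (ord_kinds w) => [w0|[v vw]|wl].
- by rewrite !stage_zero //; exact/is_zero_Some.
- rewrite (stage_succ _ _ _ vw) -IH; last by case: vw.
  exact/stage_succ/is_succ_Some.
- rewrite !stage_limit //; last exact/is_limit_Some.
  congr lim; apply/seteqP; split=> [_ [[v|] //= vw <-]|_ [v vw <-]].
    by exists v => //; rewrite -IH.
  by exists (Some v) => //; rewrite IH.
Qed.

Lemma is_succ_None : is_succ_of (Some None : osucc (osucc a)) None.
Proof. by split => // -[[v|]|//] _; [right|left]. Qed.

End Successor.

(** * The label of the finite chains of a tree of descending sequences *)

Definition msize (p : {mset nat}%mset) : nat := size p.

Lemma msizeD (p q : FIN) : msize (p `+` q)%mset = (msize p + msize q)%N.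
Proof.
rewrite /msize -size_cat; apply/perm_size/allP => x _ /=.
by rewrite count_cat !count_mem_mset msetE2.
Qed.

Lemma msize_fle (p q : FIN) : fle p q -> (msize p <= msize q)%N.
Proof. by move=> /fle_subK <-; rewrite msizeD leq_addr. Qed.

Lemma msize_gt0 (p : FIN) : p <> mset0 -> (0 < msize p)%N.
Proof. by move=> /eqP; rewrite lt0n size_mset_eq0. Qed.

Lemma fle_neq0 (p q : FIN) l : fle p q -> p l != 0%N -> q l != 0%N.
Proof. by move=> pq; rewrite -!lt0n => /leq_trans; exact. Qed.

Definition below (F : FIN) : label.
Proof. by exists [set m | fle m F] => m1 m mF m1m l; exact: leq_trans (mF l). Defined.

Lemma finite_below F : finite_set (below F : set FIN).
Proof.
have [n Fn] := label_box_cover F; apply: sub_finite_set (finite_label_box n) => m mF.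
split=> l; first exact: leq_ltn_trans (mF l) (Fn.1 l).
by move=> /(fle_neq0 mF)/Fn.2.
Qed.

Lemma below0 : below mset0 = zero_label.
Proof.
apply: label_eq; apply/seteqP; split => [m /= h|m -> //].
exact: fle_anti (fle0 _).
Qed.

Section ChainLabel.
Variables (a : Ord) (code : seq {classic a} -> nat).
Hypothesis codeI : injective code.
Local Notation node := (seq {classic a}).
Implicit Types s u v : node.

Definition above (v w : osucc a) : bool := `[< ord_lt w v >].

Lemma above_trans : transitive above.
Proof. by move=> v u w /asboolP uv /asboolP vw; apply/asboolP; exact: ord_trans uv. Qed.

(** [osucc a] has [a] itself on top, which serves as the root of the tree. *)
Definition entries s : seq (osucc a) := None :: map Some s.
Definition entry s i : osucc a := nth None (entries s) i.
Definition desc s : bool := path above None (map Some s).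
Definition bottom s : osucc a := last None (map Some s).

Lemma desc_rcons s x : desc (rcons s x) = desc s && above (bottom s) (Some x).
Proof. by rewrite /desc map_rcons rcons_path. Qed.

Lemma bottom_rcons s x : bottom (rcons s x) = Some x.
Proof. by rewrite /bottom map_rcons last_rcons. Qed.

Lemma desc_prefix u s : prefix u s -> desc s -> desc u.
Proof. by move=> /prefixP[t ->]; rewrite /desc map_cat cat_path => /andP[]. Qed.

Lemma desc_nth s i j : desc s -> (i < j <= size s)%N ->
  ord_lt (entry s j) (entry s i).
Proof.
move=> ds /andP[ij js]; apply/asboolP.
apply: (sorted_ltn_nth (leT := above) above_trans None (s := entries s) ds) => //;
  by rewrite inE /= size_map; lia.
Qed.

Definition prefixes s : seq node := [seq take i.+1 s | i <- iota 0 (size s)].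

Lemma prefixes_rcons s x : prefixes (rcons s x) = rcons (prefixes s) (rcons s x).
Proof.
rewrite /prefixes size_rcons -addn1 iotaD map_cat /= cats1 add0n.
congr rcons; last by rewrite take_oversize // size_rcons.
apply/eq_in_map => i; rewrite mem_iota /= add0n => ilt.
by rewrite -cats1 takel_cat.
Qed.

Lemma mem_prefixes s u : (u \in prefixes s) = (u != [::]) && prefix u s.
Proof.
elim/last_ind: s => [|s x IH].
  by rewrite prefixs0; case: u.
rewrite prefixes_rcons mem_rcons inE IH.
have [->|nu] := eqVneq u (rcons s x); first by rewrite prefix_refl; case: s {IH}.
congr (_ && _); apply/idP/idP => [h|]; first exact: prefix_trans (prefix_rcons _ _).
move/prefixP => [t]; case/lastP: t => [|t y].
  by rewrite cats0 => uE; rewrite uE eqxx in nu.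
by rewrite -rcons_cat => /rcons_inj[-> _]; exact: prefix_prefix.
Qed.

Lemma prefixes_uniq s : uniq (prefixes s).
Proof.
elim/last_ind: s => [//|s x IH]; rewrite prefixes_rcons rcons_uniq IH andbT.
rewrite mem_prefixes negb_and; apply/orP; right; apply/negP => /size_prefix.
by rewrite size_rcons ltnn.
Qed.

Definition branch s : FIN := seq_mset [seq code u | u <- prefixes s].

Lemma branchE s l : branch s l = (l \in [seq code u | u <- prefixes s]) :> nat.
Proof. by rewrite mset_seqE count_uniq_mem // map_inj_uniq // prefixes_uniq. Qed.

Lemma branch_code s u : branch s (code u) = ((u != [::]) && prefix u s) :> nat.
Proof. by rewrite branchE mem_map // mem_prefixes. Qed.

Lemma branch_le1 s l : (branch s l <= 1)%N.
Proof. by rewrite branchE leq_b1. Qed.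

Lemma branch_neq0 s l : branch s l != 0%N ->
  exists u, [/\ l = code u, u != [::] & prefix u s].
Proof.
rewrite branchE eqb0 negbK => /mapP[u]; rewrite mem_prefixes => /andP[u0 us] ->.
by exists u.
Qed.

Lemma branch_rcons s x :
  branch (rcons s x) = (branch s `+` [mset code (rcons s x)])%mset.
Proof.
apply/msetP => l; rewrite msetE2 msetnE !mset_seqE prefixes_rcons map_rcons.
by rewrite -cats1 count_cat /= addn0 eq_sym; case: eqP.
Qed.

Lemma branch_nil : branch [::] = mset0.
Proof. by apply/msetP => l; rewrite mset_seqE mset0E. Qed.

Lemma msize_branch s : msize (branch s) = size s.
Proof.
elim/last_ind: s => [|s x IH]; first by rewrite branch_nil /msize size_mset0.
by rewrite branch_rcons msizeD IH /msize enum_msetn size_rcons addn1.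
Qed.

Lemma branch_prefix u s : prefix u s -> fle (branch u) (branch s).
Proof.
move=> us l; have [->//|/branch_neq0[v [-> v0 vu]]] := eqVneq (branch u l) 0%N.
by rewrite !branch_code v0 vu (prefix_trans vu us).
Qed.

Lemma fle_code q s u : fle q (branch s) -> q (code u) != 0%N -> prefix u s.
Proof.
move=> qs qu; have : branch s (code u) != 0%N.
  exact: fle_neq0 qu.
by rewrite branch_code; case: (prefix u s); rewrite ?andbF.
Qed.

(** Among comparable nodes the lengths are distinct, so [q] contains a node of
    length at least [msize q], and this node fixes the entries up to there. *)
Lemma fle_branch_take q s s' : fle q (branch s) -> fle q (branch s') ->
  take (msize q) s = take (msize q) s'.
Proof.
move=> qs qs'; apply: contrapT => ne.
have [q0|q0] := posnP (msize q); first by case: ne; rewrite q0 !take0.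
suff /msize_fle : fle q (branch (take (msize q).-1 s)).
  by rewrite msize_branch size_take; case: ltnP; lia.
move=> l; have [->//|ql] := eqVneq (q l) 0%N.
have [u [lE u0 us]] : exists u, [/\ l = code u, u != [::] & prefix u s].
  exact: branch_neq0 (fle_neq0 qs ql).
apply: leq_trans (qs l) _; rewrite lE !branch_code u0 us /=.
have us' : prefix u s' by apply: (fle_code qs'); rewrite -lE.
have su : (size u < msize q)%N.
  rewrite ltnNge; apply/negP => qu; apply: ne.
  have tk t : prefix u t -> take (msize q) t = take (msize q) u.
    by move=> /prefixP[t' ->]; rewrite takel_cat.
  by rewrite !tk.
have -> // : prefix u (take (msize q).-1 s).
rewrite prefixE take_takel; last by rewrite -ltnS prednK.
by rewrite -prefixE.
Qed.

(** These are the finite sets of pairwise comparable nodes of the tree, each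
    contained in a branch. *)
Definition chain_label : label.
Proof.
exists [set m | exists2 s, desc s & fle m (branch s)].
by move=> m1 m [s ds ms] m1m; exists s => // l; exact: leq_trans (ms l).
Defined.
Local Notation M := chain_label.

Lemma chain_label_branch s : desc s -> (M : set FIN) (branch s).
Proof. by exists s. Qed.

(** Cutting a branch at the last node that the vector uses. *)
Lemma chain_label_tight q : (M : set FIN) q ->
  exists s, [/\ desc s, fle q (branch s) & s != [::] -> q (code s) != 0%N].
Proof.
move=> [s]; elim/last_ind: s => [|s x IH] ds qs; first by exists [::].
have [qx|qx] := eqVneq (q (code (rcons s x))) 0%N; last by exists (rcons s x).
apply: IH; first by move: ds; rewrite desc_rcons => /andP[].
move=> l; have := qs l; rewrite branch_rcons msetE2 msetnE.
by case: eqP => [->|_]; rewrite ?addn0 // qx.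
Qed.

Lemma shift_below_rcons s x :
  shift_label [mset code (rcons s x)]%mset (below (branch (rcons s x))) =
  below (branch s).
Proof.
apply: label_eq; apply/seteqP; split => m /= h l; have := h l.
  by rewrite branch_rcons !msetE2 leq_add2r.
by rewrite branch_rcons !msetE2 leq_add2r.
Qed.

(** A node ending in the least element has no proper extension, so removing
    it leaves only what lies on its branch. *)
Lemma shift_leaf F s (x : a) : is_zero x -> desc (rcons s x) ->
  shift_label (F `+` [mset code (rcons s x)])%mset M = shift_label F (below (branch s)).
Proof.
move=> x0 dsx; apply: label_eq; apply/seteqP; split => m /=.
- move=> [s' ds' ms']; have /prefixP[t s'E] : prefix (rcons s x) s'.
    by apply: fle_code ms' _; rewrite !msetE2 msetnxx !addn_eq0 !andbF.
  case: t s'E => [|y t] s'E; last first.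
    move: ds'; rewrite s'E -cat_rcons => /(desc_prefix (prefix_prefix _ _)).
    by rewrite desc_rcons bottom_rcons => /andP[_ /asboolP /x0].
  move=> l; have := ms' l; rewrite s'E cats0 branch_rcons !msetE2 addnA.
  by rewrite leq_add2r.
- move=> h; exists (rcons s x) => // l; rewrite branch_rcons msetDA !msetE2 leq_add2r.
  by have := h l; rewrite msetE2.
Qed.

(** Follow the branches through the [r i] down from the root as long as the
    ultrafilter agrees on the next node. The entries decrease, so this stops at
    some node [s]. If most branches end there, [r i] ranges over a finite set.
    If they go on, they scatter, and a vector that is compatible with most of
    them lies on the branch of [s]; the leaf below [s] realises this limit by a
    translate. *)
Lemma ulim_chain_label (I : Type) (U : set_system I) (UU : UltraFilter U)
    (r : I -> FIN) : U [set i | (M : set FIN) (r i)] ->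
  (exists F, U [set i | r i = F]) \/
  (exists F s (x : a), [/\ is_zero x, desc (rcons s x) &
    ulim UU (fun i => shift_label (r i) M) = shift_label F (below (branch s))]).
Proof.
move=> UM.
have ex i : exists s, (M : set FIN) (r i) ->
    [/\ desc s, fle (r i) (branch s) & s != [::] -> r i (code s) != 0%N].
  have [/chain_label_tight[s hs]|nM] := pselect ((M : set FIN) (r i)).
    by exists s.
  by exists [::].
have [s sP] := choice ex.
have [u [du uU umax]] : exists u, [/\ desc u, U [set i | prefix u (s i)] &
    forall x, ~ U [set i | prefix (rcons u x) (s i)]].
  suff h (w : osucc a) u : bottom u = w -> desc u -> U [set i | prefix u (s i)] ->
      exists u, [/\ desc u, U [set i | prefix u (s i)] &
      forall x, ~ U [set i | prefix (rcons u x) (s i)]].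
    by apply: (h None [::]) => //; apply: filterE => i /=; exact: prefix0s.
  elim/(well_founded_ind (@ord_wf (osucc a))): w u => w IH u uw du uU.
  have [[x xU]|nx] := pselect (exists x, U [set i | prefix (rcons u x) (s i)]); last first.
    by exists u; split => // x xU; apply: nx; exists x.
  have [i [/= /sP[dsi _ _] pi]] := filter_ex (filterI UM xU).
  have dx := desc_prefix pi dsi.
  apply: (IH (Some x) _ (rcons u x)) => //; last exact: bottom_rcons.
  by move: dx; rewrite desc_rcons uw => /andP[_ /asboolP].
have [sU|/(ultra_notin UU) sU] := pselect (U [set i | s i = u]).
  left; have rU : U [set i | (below (branch u) : set FIN) (r i)].
    by apply: filterS (filterI UM sU) => i [/= /sP[_ + _] <-].
  by have [F _ hF] := ultra_pigeon UU (finite_below (branch u)) rU; exists F.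
have {}sU : U [set i | [/\ (M : set FIN) (r i), prefix u (s i) & s i <> u]].
  by apply: filterS (filterI UM (filterI uU sU)) => i [? []].
have cU : U [set i | (below (branch u) : set FIN) (r i `&` branch u)%mset].
  by apply: filterE => i l; rewrite msetE2 geq_minr.
have [F _ FU] := ultra_pigeon UU (finite_below (branch u)) cU.
(* a branch containing [r i] passes through [s i], so it leaves [u] on the
   same side *)
have next i s' : (M : set FIN) (r i) -> prefix u (s i) -> s i <> u ->
    fle (r i) (branch s') -> exists x, prefix (rcons u x) (s i) /\ prefix (rcons u x) s'.
  move=> /sP[_ _ top] /prefixP[t st] su rs'; case: t st => [|x t] st.
    by rewrite cats0 in st.
  have xs : prefix (rcons u x) (s i) by rewrite st -cat_rcons prefix_prefix.
  exists x; split => //; apply: prefix_trans xs _; apply: fle_code rs' (top _).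
  by rewrite st; case: (u).
right; have [i [rM us su]] := filter_ex sU.
have [dsi ri _] := sP i rM; have [x [xs _]] := next i _ rM us su ri.
have := desc_prefix xs dsi; rewrite desc_rcons => /andP[_ /asboolP xu].
have [o [_ o0]] := @ord_min a (fun=> True) (ex_intro _ x Logic.I).
have ox : ord_le o x by apply/ord_leNgt => /o0.
exists F, u, o; split; first by move=> v /o0.
  rewrite desc_rcons du; apply/asboolP.
  case: ox => [->//|ox]; exact: (@ord_trans (osucc a) (Some o) (Some x)).
apply: label_eq; apply/seteqP; split => m /=.
- move=> mU l; apply: contrapT => ml.
  have mFE j : F = (r j `&` branch u)%mset -> (m l + F l <= branch u l)%N \/ m l != 0%N.
    move=> ->; case: eqVneq => [->|_]; [left|by right].
    by rewrite msetE2 geq_minr.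
  have [j [[/= Fj mj] [rj uj suj]]] := filter_ex (filterI (filterI FU mU) sU).
  case: (mFE j (esym Fj)) => [|ml0]; first by rewrite -msetE2 => /ml.
  have [s' ds' ms'] := mj.
  have ms's k s'' : fle (m `+` r k)%mset (branch s'') -> fle m (branch s'').
    by apply: fle_trans; exact: fleDl.
  have [v [lE v0 vs']] : exists v, [/\ l = code v, v != [::] & prefix v s'].
    exact: branch_neq0 (fle_neq0 (ms's _ _ ms') ml0).
  have vu : ~~ prefix v u.
    apply/negP => vu; apply: ml; rewrite msetE2 -Fj msetE2.
    have bu : branch u l = 1%N by rewrite lE branch_code v0 vu.
    have := ms' l; rewrite msetE2; have := branch_le1 s' l; rewrite bu; lia.
  have vU : U [set k | prefix (take (size u).+1 v) (s k)].
    apply: filterS (filterI mU sU) => k [/= [s1 ds1 ms1] [rk uk suk]].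
    have [y [ys ys1]] := next k s1 rk uk suk (fle_trans (fleDr _ _) ms1).
    have vs1 : prefix v s1 by apply: fle_code (ms's _ _ ms1) _; rewrite -lE.
    have uv : (size u < size v)%N.
      rewrite ltnNge; apply/negP => h; case/negP: vu; move: ys1 vs1.
      move=> /prefixP[t1 ->] /prefixP[t2]; rewrite cat_rcons => tE.
      by rewrite prefixE -(takel_cat (y :: t1) h) tE take_size_cat.
    suff -> : take (size u).+1 v = rcons u y by [].
    move: ys1 vs1 => /prefixP[t1 ->] /prefixP[t2] tE.
    by rewrite -(takel_cat t2 uv) -tE take_size_cat // size_rcons.
  have [y [ys ys1]] := next j s' rj uj suj (fle_trans (fleDr _ _) ms').
  apply: (umax y); apply: filterS vU => k /=; congr (prefix _ _).
  move: ys1 vs' => /prefixP[t1 ->] /prefixP[t2] tE.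
  have uv : (size u < size v)%N.
    rewrite ltnNge; apply/negP => h; case/negP: vu.
    by rewrite prefixE -(takel_cat (y :: t1) h) -cat_rcons tE take_size_cat.
  by rewrite -(takel_cat t2 uv) -tE take_size_cat // size_rcons.
- move=> mF; apply: filterS (filterI FU sU) => j [/= Fj [rj uj suj]].
  have [dj rsj _] := sP j rj; exists (s j) => // l; rewrite msetE2.
  have := mF l; rewrite msetE2 -Fj msetE2; have := branch_prefix uj l.
  have := rsj l; have := branch_le1 (s j) l; have := branch_le1 u l.
  rewrite /minn; case: ltnP; lia.
Qed.

End ChainLabel.

(** * Stages of the label iterations *)

Section GoodSets.
Variable M : label.
Hypotheses (sM : simple_label M) (fM : chainless M).

(** The empty label belongs to every nonempty closed invariant set, so the last
    clause excludes the empty set only. *)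
Definition good (Phi : set label) :=
  [/\ closure Phi `<=` Phi, forall r N, Phi N -> Phi (shift_label r N),
      Phi `<=` Theta M & Phi empty_label].

Lemma good_Theta : good (Theta M).
Proof.
split => //; first exact: closed_closure.
  by move=> r N; exact: Theta_shift.
exact: Theta_empty.
Qed.

Lemma zLAB_sub Phi : good Phi -> zLAB Phi `<=` Phi.
Proof.
move=> [cP iP _ _]; apply: subset_trans cP; apply: closureS.
by move=> _ [r _ [N PN <-]]; exact: iP.
Qed.

Lemma good_zLAB Phi : good Phi -> good (zLAB Phi).
Proof.
move=> gP; have [cP iP TP P0] := gP; split.
- exact: closed_closure.
- move=> r; apply: closure_map; first exact: shift_label_continuous.
  move=> _ [s s0 [N PN <-]]; exists s => //; exists (shift_label r N).
    exact: iP.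
  by rewrite !shift_labelD msetDC.
- exact: subset_trans (zLAB_sub gP) TP.
- apply: subset_closure; exists [mset 0%N]%mset; last first.
    by exists empty_label => //; rewrite shift_label_empty.
  by apply/eqP => /msetP/(_ 0%N); rewrite msetnxx mset0E.
Qed.

Lemma good_bigcap (F : set (set label)) : F !=set0 ->
  (forall A, F A -> good A) -> good (\bigcap_(A in F) A).
Proof.
move=> [A0 FA0] gF; split.
- move=> N cN A FA; have [cA _ _ _] := gF A FA; apply: cA.
  by move: N cN; apply: closureS; exact: bigcap_inf.
- by move=> r N FN A FA; have [_ iA _ _] := gF A FA; exact: iA (FN A FA).
- by move=> N /(_ _ FA0); have [_ _ + _] := gF A0 FA0; exact.
- by move=> A FA; have [] := gF A FA.
Qed.

Lemma label_stage_mono (a : Ord) (w : a) : good (dec_stage zLAB (Theta M) w) /\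
  forall v, ord_lt v w ->
    dec_stage zLAB (Theta M) w `<=` dec_stage zLAB (Theta M) v.
Proof.
apply: (dec_stage_mono (G := good)).
- exact: good_Theta.
- by move=> A gA; split; [exact: good_zLAB|exact: zLAB_sub].
- exact: good_bigcap.
Qed.

(** The first and the last clause make [zLAB_star] enlarge the set. *)
Definition star_good (Phi : set label) :=
  [/\ Phi `<=` Theta M, Phi empty_label & forall N, Phi N -> Theta' N `<=` Phi].

Lemma Theta'_empty_label : Theta' empty_label `<=` [set empty_label].
Proof.
rewrite (Theta'_simple sM fM); last exact: Theta_empty.
by move=> _ [r _ <-]; rewrite shift_label_empty.
Qed.

Lemma star_stage_mono (a : Ord) (w : a) :
  star_good (inc_stage (zLAB_star M) [set empty_label] w) /\
  forall v, ord_lt v w -> inc_stage (zLAB_star M) [set empty_label] v `<=`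
    inc_stage (zLAB_star M) [set empty_label] w.
Proof.
have T0 := Theta_empty sM fM; apply: (inc_stage_mono (G := star_good)).
- by split => // N ->; [exact: T0|exact: Theta'_empty_label].
- move=> A [TA A0 iA]; have Az : A `<=` zLAB_star M A.
    by move=> N AN; split; [exact: TA|exact: iA].
  split => //; split; [by move=> N []|exact: Az|].
  by move=> N [_ NA]; exact: subset_trans NA Az.
- move=> F [A0 FA0] gF; split.
  + by move=> N [A FA AN]; have [TA _ _] := gF A FA; exact: TA.
  + by exists A0 => //; have [] := gF A0 FA0.
  + move=> N [A FA AN] N' NN'; exists A => //.
    by have [_ _ iA] := gF A FA; exact: iA AN _ NN'.
Qed.

End GoodSets.

Section ChainLabelHeight.
Variables (a : Ord) (code : seq {classic a} -> nat).
Hypothesis codeI : injective code.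
Local Notation node := (seq {classic a}).
Local Notation M := (chain_label code).
Local Notation branch := (branch code).

Lemma chain_label_le1 (m : FIN) l : (M : set FIN) m -> (m l <= 1)%N.
Proof. by move=> [s _ ms]; apply: leq_trans (ms l) _; exact: branch_le1. Qed.

Lemma chain_label_simple : simple_label M.
Proof.
apply/seteqP; split; last exact: subset_closure.
move=> N /closure_shift_ulim[U [UU [r [_ ->]]]].
have [rU|/(ultra_notin UU) rU] := pselect (U [set i | (M : set FIN) (r i)]).
  have [[F FU]|[F [s [x [x0 ds ->]]]]] := ulim_chain_label codeI UU rU.
    exists F => //; apply/esym/ulim_const.
    by apply: filterS FU => i /= ->.
  exists (F `+` [mset code (rcons s x)])%mset => //.
  exact: shift_leaf.
exists (msetn 2 0%N) => //; rewrite shift_label_notin; last first.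
  by move=> /(@chain_label_le1 _ 0%N); rewrite msetnxx.
apply/esym/ulim_const; apply: filterS rU => i nM; exact: shift_label_notin nM.
Qed.

(** A sequence with infinitely many points in its supports runs, along a
    suitable ultrafilter, out of every finite set of vectors; the limit of
    the translates is then finite, and it contains the set in question. *)
Lemma chain_label_finitary : finitary_label M.
Proof.
split=> [l|r]; first by exists 1%N => m; exact: chain_label_le1.
set R := (X in infinite_set X) => Rinf.
have ex l : exists j, R l -> r j l != 0%N.
  by have [[j _ rj]|nR] := pselect (R l); [exists j|exists 0%N].
have [j jP] := choice ex.
pose small A := finite_set (R `&` j @^-1` (~` A)).
have PF : ProperFilter small.
  apply: Build_ProperFilter_ex => [A sA|].
    apply: contrapT => nA; apply: Rinf; apply: sub_finite_set sA => l Rl.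
    by split => // Aj; apply: nA; exists (j l).
  split.
  - by rewrite /small setCT preimage_set0 setI0.
  - move=> A B sA sB; have := conj sA sB; rewrite -finite_setU.
    by apply: sub_finite_set => l [Rl /not_andP[]]; [left|right].
  - by move=> A B AB; apply: sub_finite_set => l [Rl nB]; split => // /AB.
have [U [UU sU]] := ultraFilterLemma PF.
have fsupp (m : FIN) : finite_set [set l | m l != 0%N].
  by apply: sub_finite_set (finite_fset (finsupp m)) => l /=; rewrite mem_finsupp.
have fin_ulim : finite_set (ulim UU (fun i => shift_label (r i) M) : set FIN).
  have [rU|/(ultra_notin UU) rU] := pselect (U [set i | (M : set FIN) (r i)]); last first.
    rewrite (_ : ulim _ _ = empty_label) //.
    by apply: ulim_const; apply: filterS rU => i nM; exact: shift_label_notin nM.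
  have [[F FU]|[F [s [x [_ _ ->]]]]] := ulim_chain_label codeI UU rU.
    have : U (~` [set i | r i = F]).
      apply: sU; apply: sub_finite_set (fsupp F) => l [Rl /= /contrapT <-].
      exact: jP.
    by move=> /(ultra_absurd UU FU).
  apply: sub_finite_set (finite_below (branch s)); exact: shift_label_sub.
apply: sub_finite_set fin_ulim => m [i _ mi] /=.
have : U [set k | (i <= k)%N].
  apply: sU; apply: sub_finite_set (bigcup_finite (finite_II i) (fun k _ => fsupp (r k))).
  by move=> l [Rl /negP]; rewrite -ltnNge => ji; exists (j l) => //=; exact: jP.
by apply: filterS => k /mi.
Qed.

Let sM := chain_label_simple.
Let fM := finitary_chainless chain_label_finitary.

Lemma entry_take (s s' : node) n : take n s = take n s' -> entry s n = entry s' n.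
Proof.
case: n => [//|n] h; rewrite /entry /= -(@nth_take n.+1) //.
by rewrite -map_take h map_take nth_take.
Qed.

Lemma entry_lt (s : node) (q r : FIN) : desc s -> fle (q `+` r)%mset (branch s) ->
  r <> mset0 -> ord_lt (entry s (msize (q `+` r)%mset)) (entry s (msize q)).
Proof.
move=> ds /msize_fle; rewrite msize_branch => qs /msize_gt0 r0.
by apply: desc_nth => //; rewrite qs msizeD; lia.
Qed.

(** Every step that keeps [N] makes room for a strictly larger vector, which
    reaches a smaller entry. *)
Lemma stage_entry (w : osucc a) N : dec_stage zLAB (Theta M) w N ->
  forall q s, (N : set FIN) q -> desc s -> fle q (branch s) ->
  ord_le w (entry s (msize q)).
Proof.
elim/(well_founded_ind (@ord_wf (osucc a))): w N => w IH N zN q s Nq ds qs.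
case: (ord_kinds w) => [w0|[v vw]|wl]; first by apply/ord_leNgt => /w0.
- move: zN; rewrite /dec_stage (stage_succ _ _ _ vw) => zN.
  have [_ [[r /eqP r0 [N' zN' <-]] /= qN']] := zN _ (nbhs_label_mem N q).
  have {}qN' := qN'.2 Nq.
  have [_ _ zT _] := (label_stage_mono sM fM v).1.
  have [s' ds' qs'] := Theta_sub sM (zT _ zN') qN'.
  have v_le := IH v vw.1 _ zN' _ _ qN' ds' qs'.
  have ss' := fle_branch_take codeI qs (fle_trans (fleDl q r) qs').
  apply/ord_leNgt; rewrite (entry_take ss') => lt.
  have := ord_le_lt_trans v_le (entry_lt ds' qs' r0).
  by move/ord_lt_le_trans => /(_ _ (succ_of_le vw lt)) /ord_irr.
- apply/ord_leNgt => lt; have [v lv vw] := limit_between wl lt.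
  move: zN; rewrite /dec_stage stage_limit // => zN.
  have zv : dec_stage zLAB (Theta M) v N by apply: zN; exists v.
  by have /ord_leNgt := IH v vw N zv q s Nq ds qs; apply.
Qed.

(** Removing the last node of a longer branch leaves a branch through its
    parent, so the label survives as long as those of the branches of the
    children of [s], whose last entries are all the smaller indices. *)
Lemma stage_below (w : osucc a) (s : node) : desc s -> bottom s = w -> ~ is_zero w ->
  dec_stage zLAB (Theta M) w (below (branch s)).
Proof.
elim/(well_founded_ind (@ord_wf (osucc a))): w s => w IH s ds sw w0.
have child v : ord_lt v w -> exists c N, [/\ c != mset0, dec_stage zLAB (Theta M) v N &
    below (branch s) = shift_label c N].
  case: v => [x|//] xw; have dx : desc (rcons s x).
    by rewrite desc_rcons ds sw; exact/asboolP.
  exists [mset code (rcons s x)]%mset.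
  have c0 : [mset code (rcons s x)]%mset != mset0.
    by apply/eqP => /msetP/(_ (code (rcons s x))); rewrite msetnxx mset0E.
  have [x0|x0] := pselect (is_zero (Some x : osucc a)).
    exists M; rewrite /dec_stage stage_zero //; split => //.
      exact: Theta_self.
    rewrite -[in RHS](mset0D [mset _]%mset) shift_leaf ?shift_label0 //.
    exact/is_zero_Some.
  exists (below (branch (rcons s x))); rewrite shift_below_rcons //; split => //.
  by apply: IH => //; rewrite bottom_rcons.
case: (ord_kinds w) => [//|[v vw]|wl].
- rewrite /dec_stage (stage_succ _ _ _ vw); apply: subset_closure.
  by have [c [N [c0 zN ->]]] := child v vw.1; exists c => //; exists N.
- rewrite /dec_stage stage_limit // => _ [v vw <-].
  have [c [N [c0 zN ->]]] := child v vw.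
  by have [[_ + _ _] _] := label_stage_mono sM fM v; exact.
Qed.

Lemma chain_label_neq0 : M <> empty_label.
Proof. by apply/label_neq0; exists [::] => //; exact: fle0. Qed.

Lemma chain_label_height : label_height_succ M a.
Proof.
split; [exact: chain_label_neq0|exact: simple_wap|].
have [[_ zi zT z0] _] := label_stage_mono sM fM (None : osucc a).
rewrite /dec_iter; apply/seteqP; split => [N zN|_ [->|->] //].
  apply: zero_labelE => q Nq; apply: contrapT => q0.
  have [s ds qs] := Theta_sub sM (zT _ zN) Nq.
  have /ord_leNgt := stage_entry zN Nq ds qs; apply.
  have := entry_lt (q := mset0) ds _ q0; rewrite mset0D => /(_ qs).
  by rewrite /msize size_mset0.
rewrite -below0 -(branch_nil code).
have [n0|n0] := pselect (is_zero (None : osucc a)); last exact: stage_below.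
rewrite /dec_stage stage_zero // (branch_nil code) below0.
have [q [qM qmax]] := chainless_max fM ((label_neq0 M).1 chain_label_neq0).
apply/(ThetaP sM); exists q; apply/esym.
have [|qE|//] := @zero_labelE (shift_label q M).
  move=> m h; apply: contrapT => m0; apply: (qmax m m0).
  by rewrite msetDC.
have : (shift_label q M : set FIN) mset0 by rewrite shift_labelE mset0D.
by rewrite qE.
Qed.

Local Notation zs := (inc_stage (zLAB_star M) [set empty_label] (a := osucc a)).

(** Passing from [F] to a larger vector moves to a smaller entry, so the entry
    reached by [F] bounds the stage at which the translate by [F] appears. *)
Lemma star_stage_entry (w : osucc a) : zs w empty_label /\
  forall F s, desc s -> fle F (branch s) -> ord_lt (entry s (msize F)) w ->
  zs w (shift_label F M).
Proof.
elim/(well_founded_ind (@ord_wf (osucc a))): w => w IH.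
rewrite /inc_stage; case: (ord_kinds w) => [w0|[v vw]|wl].
- by rewrite stage_zero //; split => // F s _ _ /w0.
- rewrite (stage_succ _ _ _ vw); have [v0 vF] := IH v vw.1; split.
    by split=> [|N /(Theta'_empty_label sM fM) ->]; [exact: Theta_empty|].
  move=> F s ds Fs lt; have TF : Theta M (shift_label F M).
    by apply/(ThetaP sM); exists F.
  split => //; rewrite (Theta'_simple sM fM) // => _ [r /eqP r0 <-].
  rewrite shift_labelD; have [[s' ds' Fs']|nM] := pselect ((M : set FIN) (F `+` r)%mset).
    apply: (vF _ s') => //; have ss' := fle_branch_take codeI Fs (fle_trans (fleDl F r) Fs').
    apply: ord_lt_le_trans (entry_lt ds' Fs' r0) _.
    by rewrite -(entry_take ss'); exact: succ_of_le vw lt.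
  by rewrite shift_label_notin.
- rewrite stage_limit //; split.
    have [v vw] := limit_lt wl; exists (zs v); first by exists v.
    by case: (IH v vw).
  move=> F s ds Fs /(limit_between wl)[v lv vw]; exists (zs v); first by exists v.
  by have [_ h] := IH v vw; exact: h lv.
Qed.

(** A child of [s] must appear before [s] does, and its branch ends in any
    prescribed smaller index. *)
Lemma star_stage_branch (w : osucc a) s : desc s ->
  zs w (shift_label (branch s) M) -> ord_lt (bottom s) w.
Proof.
elim/(well_founded_ind (@ord_wf (osucc a))): w s => w IH s ds.
rewrite /inc_stage; case: (ord_kinds w) => [w0|[v vw]|wl].
- rewrite stage_zero // => /= h.
  have : (shift_label (branch s) M : set FIN) mset0.
    by rewrite /= mset0D; exact: chain_label_branch.
  by rewrite h.
- rewrite (stage_succ _ _ _ vw) => -[TN zN].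
  apply: contrapT => /ord_leNgt /(ord_lt_le_trans vw.1).
  case: v vw zN => [x vw zN|[]//] xs.
  have dx : desc (rcons s x) by rewrite desc_rcons ds; exact/asboolP.
  have := IH (Some x) vw.1 (rcons s x) dx; rewrite bottom_rcons => h.
  apply: (@ord_irr (osucc a) (Some x)); apply: h; apply: zN.
  rewrite (Theta'_simple sM fM) //; exists [mset code (rcons s x)]%mset.
    by apply/eqP => /msetP/(_ (code (rcons s x))); rewrite msetnxx mset0E.
  by rewrite shift_labelD branch_rcons.
- rewrite stage_limit // => -[_ [v vw <-]] /(IH v vw s ds) sv.
  exact: ord_trans sv vw.
Qed.

Lemma chain_label_height_star : label_height_star_succ M a.
Proof.
split; [exact: chain_label_neq0|exact: simple_wap|].
have [z0 zF] := star_stage_entry None.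
rewrite /inc_iter (Theta'_simple sM fM); last exact: Theta_self.
apply/seteqP; split => [N zN|_ [r /eqP r0 <-]].
  have [[zT _ _] _] := star_stage_mono sM fM (None : osucc a).
  have /(ThetaP sM)[r NE] := zT _ zN; exists r => //.
  apply/eqP => r0; have /= := @star_stage_branch None [::] (erefl _).
  by rewrite branch_nil -r0 -NE; apply.
have [[s ds rs]|nM] := pselect ((M : set FIN) r); last by rewrite shift_label_notin.
apply: (zF _ s) => //.
have := entry_lt (q := mset0) ds _ r0; rewrite mset0D => /(_ rs).
by rewrite /msize size_mset0.
Qed.

End ChainLabelHeight.

Lemma countable_code (a : Ord) : countable_ordinal a ->
  exists code : seq {classic a} -> nat, injective code.
Proof.
move=> /countable_injP[f fI].
exists (fun s => choice.pickle (map (f : {classic a} -> nat) s)).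
move=> s s' /(pcan_inj choice.pickleK) /inj_map; apply => x y.
by apply: fI; rewrite inE.
Qed.

Theorem exists_label (a : Ord) : countable_ordinal a ->
  exists M : label, [/\ simple_label M, finitary_label M,
    label_height_succ M a & label_height_star_succ M a].
Proof.
move=> /countable_code[code codeI]; exists (chain_label code); split.
- exact: chain_label_simple.
- exact: chain_label_finitary.
- exact: chain_label_height.
- exact: chain_label_height_star.
Qed.

(** * Signed expansions *)

Local Open Scope ring_scope.

Section Digits.
Variable b : nat.
Hypothesis b_ge3 : (3 <= b)%N.
Implicit Types (d e : nat -> int).

Definition digit_sum d B : int := \sum_(n < B) d n * b%:Z ^+ n.

Lemma digit_sumSl d B : digit_sum d B.+1 = d 0%N + b%:Z * digit_sum (fun n => d n.+1) B.
Proof.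
rewrite /digit_sum big_ord_recl expr0 mulr1; congr (_ + _).
rewrite big_distrr; apply: eq_bigr => n _ /=.
by rewrite /bump /= exprS mulrCA.
Qed.

(** Modulo [b] the lowest digit vanishes, hence it is zero, being small. *)
Lemma digit_sum_eq0 e B : (forall n, `|e n| <= 2) -> digit_sum e B = 0 ->
  forall n, (n < B)%N -> e n = 0.
Proof.
elim: B e => [//|B IH] e e2; rewrite digit_sumSl => e0.
have [e00 S0] : e 0%N = 0 /\ digit_sum (fun n => e n.+1) B = 0.
  have b3 : 3 <= b%:Z by rewrite lez_nat.
  have := e2 0%N; move: e0 b3; move: (digit_sum _ _) (e 0%N) (b%:Z) => S x c e0 c3 x2.
  suff S0 : S = 0 by split => //; lia.
  by have [S0|S0|//] := ltgtP S 0; nia.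
by case=> [//|n] /(IH (fun n => e n.+1) (fun n => e2 n.+1) S0).
Qed.

Lemma digit_sum_bound d J : (forall n, `|d n| <= 1) ->
  2 * `|digit_sum d J| < b%:Z ^+ J.
Proof.
move=> d1; elim: J => [|J IH]; first by rewrite /digit_sum big_ord0 expr0.
rewrite /digit_sum big_ord_recr /= -/(digit_sum d J).
have b3 : 3 <= b%:Z by rewrite lez_nat.
have p0 : 0 <= b%:Z ^+ J by apply: exprn_ge0.
have := d1 J; move: IH b3 p0; rewrite exprS.
move: (digit_sum _ _) (d J) (b%:Z) (_ ^+ J) => S x B p h1 B3 p0 x1.
have h3 : 3 * p <= B * p by nia.
have [->|[->|->]] : x = 0 \/ x = 1 \/ x = -1 by lia.
- by lia.
- by lia.
- by lia.
Qed.

Implicit Types js h : seq int.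

Definition value js : int := \sum_(j <- js) kfun b j.

Definition digit js n : int := \sum_(j <- js) (if `|j|%N == n.+1 then Num.sg j else 0).

Lemma kfun_digit (j : int) B : (`|j| <= B)%N ->
  kfun b j = digit_sum (fun n => if `|j|%N == n.+1 then Num.sg j else 0) B.
Proof.
move=> jB; rewrite /digit_sum /kfun; have [->|j0] := eqVneq j 0.
  rewrite sgr0 mul0r big1 // => n _; by rewrite mul0r.
have jlt : (`|j|.-1 < B)%N by lia.
have jp : `|j|.-1.+1 = `|j|%N by lia.
rewrite (bigD1 (Ordinal jlt)) //= jp eqxx big1 ?addr0 // => n nj.
case: eqP => [jn|_]; last by rewrite mul0r.
by case/eqP: nj; apply: val_inj => /=; rewrite jn.
Qed.

Lemma value_digit js B : all (fun j : int => `|j| <= B)%N js ->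
  value js = digit_sum (digit js) B.
Proof.
move=> /allP jsB; rewrite /digit_sum /digit.
under eq_bigr do rewrite big_distrl /=.
rewrite exchange_big /=; apply: eq_big_seq => j /jsB; exact: kfun_digit.
Qed.

Lemma value_cat js h : value (js ++ h) = value js + value h.
Proof. exact: big_cat. Qed.

Lemma value_perm js h : perm_eq js h -> value js = value h.
Proof. exact: perm_big. Qed.

Lemma value_high_dvd js J : all (fun j : int => J < `|j|)%N js ->
  exists c : int, value js = b%:Z ^+ J * c.
Proof.
elim: js => [|j js IH] /=; first by exists 0; rewrite /value big_nil mulr0.
move=> /andP[Jj /IH[c jsc]]; exists (Num.sg j * b%:Z ^+ (`|j|.-1 - J) + c).
rewrite /value big_cons -/(value js) jsc /kfun mulrDr mulrCA -exprD; congr (_ * _ ^+ _ + _).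
lia.
Qed.

Variable pos : bool.

(** Opposite indices would cancel, hence the condition on absolute values. The
    flag lets one development serve both families of integer sets. *)
Definition reduced js : bool :=
  uniq [seq `|j|%N | j <- js] && all (fun j : int => (j != 0) && (pos ==> (0 < j))) js.

Lemma reduced_uniq js : reduced js -> uniq js.
Proof. by move=> /andP[/map_uniq]. Qed.

Lemma reduced_filter (p : pred int) js : reduced js -> reduced [seq j <- js | p j].
Proof.
move=> /andP[u a]; apply/andP; split.
  by apply: subseq_uniq u; apply: map_subseq; exact: filter_subseq.
by apply/allP => j; rewrite mem_filter => /andP[_ /(allP a)].
Qed.

Lemma reduced_nil : reduced [::]. Proof. by []. Qed.

Lemma digit_notin js n : n.+1 \notin [seq `|j|%N | j <- js] -> digit js n = 0.
Proof.
move=> nj; rewrite /digit big_seq big1 // => j jjs.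
by case: eqP => // jn; case/negP: nj; rewrite -jn map_f.
Qed.

Lemma digit_in js j : reduced js -> j \in js -> digit js `|j|.-1 = Num.sg j.
Proof.
elim: js => [//|i js IH] /andP[/= /andP[ijs ujs] /andP[/andP[i0 ip] ajs]].
rewrite /digit inE big_cons -/(digit js _) => /orP[/eqP ->|jjs].
  rewrite prednK ?absz_gt0 // eqxx digit_notin ?addr0 //.
  by rewrite prednK ?absz_gt0.
have j0 : (0 < `|j|)%N by have /andP[] := allP ajs j jjs; rewrite absz_gt0.
rewrite IH //; last by apply/andP.
rewrite prednK //; case: eqP => [ij|_]; last by rewrite add0r.
by case/negP: ijs; rewrite ij map_f.
Qed.

Lemma digit_le1 js n : reduced js -> `|digit js n| <= 1.
Proof.
move=> rjs; have [/mapP[j jjs nj]|nj] := boolP (n.+1 \in [seq `|j|%N | j <- js]).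
  have -> : n = `|j|.-1 by rewrite -nj.
  by rewrite digit_in //; case: sgrP; rewrite ?normr0 ?normrN ?normr1.
by rewrite digit_notin ?normr0.
Qed.

Lemma mem_digit js j : reduced js -> j != 0 ->
  (j \in js) = (digit js `|j|.-1 == Num.sg j).
Proof.
move=> rjs j0; apply/idP/eqP => [|dj]; first exact: digit_in.
have [/mapP[i ijs ni]|nj] := boolP (`|j|.-1.+1 \in [seq `|j|%N | j <- js]); last first.
  by move: dj; rewrite digit_notin // => /esym/eqP; rewrite sgr_eq0 (negbTE j0).
suff -> : j = i by [].
have ij : `|j|%N = `|i|%N by move: ni; rewrite prednK // absz_gt0.
move: dj; rewrite ij digit_in // => sg.
by rewrite [LHS]numEsg [RHS]numEsg sg -!abszE ij.
Qed.

(** The digits of the difference have absolute value at most two, less than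
    the base. *)
Lemma reduced_unique js h : reduced js -> reduced h -> value js = value h -> perm_eq js h.
Proof.
move=> rj rh e; apply: uniq_perm; rewrite ?reduced_uniq // => j.
pose B := (\max_(i <- js ++ h) `|i|)%N.
have bnd : all (fun i : int => `|i| <= B)%N (js ++ h).
  by apply/allP => i ih; rewrite /B (big_rem i) //= leq_maxl.
move: bnd; rewrite all_cat => /andP[bj bh].
have [j0|j0] := eqVneq j 0.
  have z g : reduced g -> (0 \in g) = false.
    by move=> /andP[_ /allP ag]; apply/negP => /ag; rewrite eqxx.
  by rewrite j0 !z.
have e0 : digit_sum (fun n => digit js n - digit h n) B = 0.
  have d0 : digit_sum (digit js) B - digit_sum (digit h) B = 0.
    by rewrite -!value_digit // e subrr.
  rewrite -[RHS]d0 /digit_sum -sumrB; apply: eq_bigr => n _; exact: mulrBl.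
have dd n : (n < B)%N -> digit js n = digit h n.
  move=> nB; apply/eqP; rewrite -subr_eq0; apply/eqP; apply: digit_sum_eq0 e0 n nB => n.
  apply: le_trans (ler_normB _ _) _.
  by rewrite (lerD (digit_le1 _ rj) (digit_le1 _ rh)).
have [jB|Bj] := leqP `|j|%N B; first by rewrite !mem_digit // dd //; lia.
have out g : all (fun i : int => `|i| <= B)%N g -> (j \in g) = false.
  by move=> /allP ag; apply/negP => /ag; rewrite leqNgt Bj.
by rewrite !out.
Qed.

Definition high J js := all (fun j : int => J < `|j|)%N js.

(** The part of [js] up to [J] is congruent to [u] modulo [b ^+ J], and both are
    too small to differ. *)
Lemma value_split J (u : int) h js : reduced h -> high J h -> 2 * `|u| < b%:Z ^+ J ->
  reduced js -> value js = u + value h ->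
  [/\ value [seq j <- js | (`|j| <= J)%N] = u &
      perm_eq js ([seq j <- js | (`|j| <= J)%N] ++ h)].
Proof.
move=> rh hh uJ rjs e; set lo := [seq j <- js | _].
pose hi := [seq j <- js | ~~ (`|j| <= J)%N].
have pj : perm_eq (lo ++ hi) js by exact: permEl (perm_filterC _ _).
have loJ : 2 * `|value lo| < b%:Z ^+ J.
  rewrite (@value_digit lo J); last exact: filter_all.
  by apply: digit_sum_bound => n; apply: digit_le1; exact: reduced_filter.
have [c1 hc1] : exists c : int, value hi = b%:Z ^+ J * c.
  apply: value_high_dvd; apply: sub_all (filter_all _ _) => j; by rewrite ltnNge.
have [c2 hc2] := value_high_dvd hh.
have e2 : value lo + value hi = u + value h by rewrite -value_cat (value_perm pj).
have [lou hihe] : value lo = u /\ value hi = value h.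
  move: e2 uJ loJ; rewrite hc1 hc2; set p := _ ^+ J; move=> e2 uJ loJ.
  have ek : p * (c1 - c2) = u - value lo by rewrite mulrBr; lia.
  suff c12 : c1 = c2 by split => //; rewrite c12 in e2 *; lia.
  have [k0|k0|/eqP] := ltgtP (c1 - c2) 0; last by rewrite subr_eq0 => /eqP.
  - by nia.
  - by nia.
split => //; rewrite perm_sym; apply: perm_trans pj; rewrite perm_cat2l.
by rewrite perm_sym; apply: reduced_unique => //; exact: reduced_filter.
Qed.

Lemma reduced_low J js : reduced js -> 2 * `|value js| < b%:Z ^+ J ->
  all (fun j : int => `|j| <= J)%N js.
Proof.
move=> rjs vJ.
have [|_ p] := @value_split J (value js) [::] js reduced_nil isT vJ rjs _.
  by rewrite /value big_nil addr0.
by rewrite (perm_all _ p) cats0 filter_all.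
Qed.

Lemma reduced_cat J js h : reduced js -> all (fun j : int => `|j| <= J)%N js ->
  reduced h -> high J h -> reduced (js ++ h).
Proof.
move=> /andP[uj aj] /allP lj /andP[uh ah] /allP hh; rewrite /reduced map_cat cat_uniq uj uh.
rewrite all_cat aj ah /= !andbT; apply/hasPn => n /mapP[j /hh Jj ->].
by apply/negP => /mapP[i /lj iJ ij]; move: Jj; rewrite ij ltnNge iJ.
Qed.

End Digits.

Lemma finite_interval (L : nat) : finite_set [set t : int | (`|t| <= L)%N].
Proof.
apply: (@sub_finite_set _ _ ((fun k : nat => k%:Z) @` `I_L.+1 `|`
    (fun k : nat => - k%:Z) @` `I_L.+1)).
  by move=> [k|k] /= kJ; [left; exists k|right; exists k.+1].
by rewrite finite_setU; split; apply: finite_image; exact: finite_II.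
Qed.

Lemma pow_big (b : nat) (u : int) : (3 <= b)%N -> exists J : nat, 2 * `|u| < b%:Z ^+ J.
Proof.
move=> b3; exists (2 * `|u|)%N; have := ltn_expl (2 * `|u|)%N (ltn_trans (ltnSn 1) b3).
by rewrite -ltz_nat PoszM abszE -[Posz (b ^ _)]natz natrX natz.
Qed.

(** * The sets of integers attached to a label *)

Section LabelSets.
Variables (b : nat) (D : nat -> set nat).
Hypothesis b_ge3 : (3 <= b)%N.
Hypothesis D_part : is_index_partition D.
Implicit Types (js h : seq int) (K M N : label) (t u v : int).

Lemma block_unique l l' n : D l n -> D l' n -> l = l'.
Proof.
have [[_ tD _] _ _] := D_part; move=> Dl Dl'.
by apply: (tD l l') => //; exists n.
Qed.

Lemma block_exists (n : nat) : (0 < n)%N -> exists l, D l n.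
Proof.
have [[cD _ _] _ _] := D_part; move=> n0.
have : cover setT D n by rewrite cD.
by move=> [l _ Dl]; exists l.
Qed.

Definition block (j : int) : nat := xget 0%N [set l | D l `|j|%N].

Lemma blockP (j : int) : j != 0 -> D (block j) `|j|%N.
Proof.
rewrite -absz_gt0 => /block_exists ex; rewrite /block; case: xgetP => // h.
by have [l Dl] := ex; case: (h l).
Qed.

Lemma block_eq (j : int) l : j != 0 -> `[< D l `|j|%N >] = (block j == l).
Proof.
move=> j0; apply/asboolP/eqP => [Dl|<-]; last exact: blockP.
exact: block_unique (blockP j0) Dl.
Qed.

Definition rvec js : FIN := seq_mset [seq block j | j <- js].

Lemma rvecE js l : rvec js l = count (fun j => block j == l) js.
Proof. by rewrite mset_seqE count_map. Qed.

Lemma rvec_cat js h : rvec (js ++ h) = (rvec js `+` rvec h)%mset.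
Proof. by apply/msetP => l; rewrite msetE2 !rvecE count_cat. Qed.

Lemma rvec_perm js h : perm_eq js h -> rvec js = rvec h.
Proof. by move=> /permP p; apply/msetP => l; rewrite !rvecE p. Qed.

Lemma rvec_nil : rvec [::] = mset0.
Proof. by apply/msetP => l; rewrite rvecE mset0E. Qed.

Lemma rvec_eq0 js : rvec js = mset0 -> js = [::].
Proof.
case: js => [//|j js] /msetP/(_ (block j)).
by rewrite rvecE mset0E /= eqxx.
Qed.

Lemma rvec_sub js h : uniq js -> {subset js <= h} -> fle (rvec js) (rvec h).
Proof.
move=> ujs sub l; rewrite !rvecE -!size_filter; apply: uniq_leq_size.
  exact: filter_uniq.
by move=> j; rewrite !mem_filter => /andP[-> /sub].
Qed.

(** Every block is infinite, so its members can be taken as large as desired. *)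
Lemma high_vector (r : FIN) J : exists h,
  [/\ forall pos, reduced pos h, high J h & rvec h = r].
Proof.
suff [h [uh ph hh rh]] : exists h, [/\ uniq [seq `|j|%N | j <- h],
    all (fun j : int => 0 < j) h, high J h & [seq block j | j <- h] = EnumMset.f r].
  exists h; split => //; last by rewrite /rvec rh seq_mset_id.
  move=> pos; apply/andP; split => //; apply: sub_all ph => j j0.
  by rewrite j0 implybT andbT gt_eqF.
elim: (EnumMset.f r) J => [|l ls IH] J; first by exists [::].
have [_ Dinf _] := D_part.
have [n Dn Jn] : exists2 n, D l n & (J < n)%N.
  apply: contrapT => nn; apply: (Dinf l); apply: sub_finite_set (finite_II J.+1) => n Dn /=.
  by rewrite ltnS leqNgt; apply/negP => Jn; apply: nn; exists n.
have [h [uh ph hh rh]] := IH n.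
have n0 : n%:Z != 0 by rewrite -absz_gt0 /=; apply: leq_ltn_trans Jn.
exists (n%:Z :: h); split => /=.
- rewrite uh andbT; apply/negP => /mapP[j /(allP hh)]; rewrite -/absz => nj /= e.
  by move: nj; rewrite -e ltnn.
- by rewrite ph andbT lt0r n0.
- by rewrite Jn; apply: sub_all hh => j; exact: ltn_trans.
- by rewrite rh; congr (_ :: _); apply/eqP; rewrite -block_eq //; exact/asboolP.
Qed.

Variable pos : bool.

Definition lset N : set int :=
  [set t | exists js, [/\ reduced pos js, t = value b js & (N : set FIN) (rvec js)]].

Lemma lset_mono K N : (K : set FIN) `<=` (N : set FIN) -> lset K `<=` lset N.
Proof. by move=> KN t [js [rj tj /KN]]; exists js. Qed.

(** Indices above [J] do not interact with the numbers of the window, and act on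
    it through their vector only. *)
Lemma lset_high J N h u : reduced pos h -> high J h -> 2 * `|u| < b%:Z ^+ J ->
  lset N (u + value b h) <-> lset (shift_label (rvec h) N) u.
Proof.
move=> rh hh uJ; split=> [[js [rjs e Njs]]|[js [rjs e /= Njs]]].
  have [lou p] := value_split b_ge3 rh hh uJ rjs (esym e).
  exists [seq j <- js | (`|j| <= J)%N]; split; first exact: reduced_filter.
    by rewrite lou.
  by rewrite /= -rvec_cat -(rvec_perm p).
exists (js ++ h); rewrite value_cat rvec_cat e; split => //.
apply: (@reduced_cat pos J) => //.
by apply: (reduced_low b_ge3 rjs); rewrite -e.
Qed.

Lemma value_nil : value b [::] = 0. Proof. exact: big_nil. Qed.

Lemma lset_neq0 N t : lset N t -> (N : set FIN) mset0.
Proof. by move=> [js [_ _ /label_down]]; apply; exact: fle0. Qed.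

Lemma lset0 N : lset N 0 <-> (N : set FIN) mset0.
Proof.
split=> [/lset_neq0 //|N0]; exists [::]; rewrite value_nil rvec_nil.
by split => //; exact: reduced_nil.
Qed.

Lemma lset_value N h : reduced pos h ->
  lset N (value b h) <-> (N : set FIN) (rvec h).
Proof.
move=> rh; split=> [[js [rjs e]]|]; last by exists h.
by rewrite (rvec_perm (reduced_unique b_ge3 rh rjs e)).
Qed.

(** Looking at [N] from a maximal vector of [N], realised far away, shows an
    isolated point; this pins down the translation. *)
Lemma lset_inj N N' c : chainless N -> (N : set FIN) mset0 ->
  (forall v, lset N v <-> lset N' (v + c)) -> N = N'.
Proof.
move=> fN N0 NN'; have [q [qN qmax]] := chainless_max fN N0.
have N'c : lset N' c by rewrite -[c]add0r; apply/NN'/lset0.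
have [J cJ] := pow_big c b_ge3.
have [h [rh hh hq]] := high_vector q J; have {}rh := rh pos.
have N'q : (N' : set FIN) q.
  have : lset N (value b h) by apply/lset_value => //; rewrite hq.
  move/NN'; rewrite addrC => /(lset_high _ rh hh cJ) /lset_neq0 /=.
  by rewrite mset0D hq.
have c0 : c = 0.
  have : lset N (- c + value b h).
    apply/NN'; rewrite addrAC addNr add0r; apply/lset_value => //.
    by rewrite hq.
  have cJ' : 2 * `|- c| < b%:Z ^+ J by rewrite normrN.
  move/(lset_high _ rh hh cJ') => [js [rjs e /= Njs]].
  have js0 : js = [::].
    apply: rvec_eq0; apply: contrapT => js0; apply: (qmax _ js0).
    by rewrite msetDC -hq.
  by apply: oppr_inj; rewrite e js0 value_nil oppr0.
apply: label_eq; apply/seteqP; split => m; have [g [rg _ <-]] := high_vector m 0.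
  by move=> /(lset_value _ (rg pos)) /NN'; rewrite c0 addr0 => /(lset_value _ (rg pos)).
by move=> /(lset_value _ (rg pos)) h'; apply/(lset_value _ (rg pos))/NN'; rewrite c0 addr0.
Qed.

(** Along an ultrafilter, the indices that stay in the expansions are finitely
    many when [M] has no infinite chain, and make up a constant; the others
    are eventually large and act as a translation of the label. *)
Lemma lset_ultra (I : Type) (U : set_system I) (UU : UltraFilter U) M
    (t : I -> int) (N : I -> label) v0 : chainless M ->
  U [set i | (N i : set FIN) `<=` (M : set FIN)] -> U [set i | lset (N i) (v0 + t i)] ->
  exists d (r : I -> FIN),
    (forall (K : I -> label) v,
       U [set i | lset (K i) (v + t i) <-> lset (shift_label (r i) (K i)) (v + d)]) /\
    U [set i | r i = mset0 -> t i = d].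
Proof.
move=> fM NM Ut.
have ex i : exists js, lset (N i) (v0 + t i) ->
    [/\ reduced pos js, v0 + t i = value b js & (N i : set FIN) (rvec js)].
  have [[js jsP]|h] := pselect (lset (N i) (v0 + t i)); first by exists js.
  by exists [::].
have [E EP] := choice ex.
have {}EP : U [set i | [/\ reduced pos (E i), t i = value b (E i) - v0 &
    (M : set FIN) (rvec (E i))]].
  apply: filterS (filterI NM Ut) => i [NiM /EP[rE e /NiM ME]]; split => //.
  by rewrite -e addrAC subrr add0r.
pose S := [set j : int | U [set i | j \in E i]].
have finS : finite_set S.
  apply: contrapT => /infinite_enum[f fI fS].
  pose m n := rvec (mkseq f n).
  apply: (fM m) => n.
    have mS : m n.+1 = (m n `+` [mset block (f n)])%mset.
      rewrite /m /mkseq -addn1 iotaD map_cat rvec_cat; congr (_ `+` _)%mset.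
      by apply/msetP => l; rewrite rvecE msetnE /= addn0 add0n eq_sym; case: eqP.
    rewrite mS; split; first exact: fleDl.
    move=> /msetD_eq/msetP/(_ (block (f n))); by rewrite msetnxx mset0E.
  have fU : U [set i | forall k, `I_n k -> f k \in E i].
    by apply: (filter_finite (finite_II n)) => k _; exact: fS.
  have [i [/= [_ _ ME] fE]] := filter_ex (filterI EP fU).
  apply: label_down ME _; apply: rvec_sub; first by rewrite mkseq_uniq.
  by move=> _ /mapP[k + ->]; rewrite mem_iota => /andP[_ kn]; exact: fE.
have [X SX] := iffLR finite_fsetP finS.
pose ds : seq int := enum_fset X.
have dsS j : j \in ds <-> S j by rewrite SX.
have dsE : U [set i | {subset ds <= E i}].
  have : U [set i | forall j, S j -> j \in E i] by exact: filter_finite.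
  by apply: filterS => i h j /dsS/h.
pose H i := [seq j <- E i | j \notin ds].
have EH : U [set i | reduced pos (H i) /\ t i = (value b ds - v0) + value b (H i)].
  apply: filterS (filterI EP dsE) => i [[rE tE _] sub] /=; rewrite tE.
  split; first exact: reduced_filter.
  rewrite addrAC -value_cat; congr (_ - _); apply: value_perm.
  have p1 : perm_eq ([seq j <- E i | j \in ds] ++ H i) (E i).
    exact: permEl (perm_filterC _ _).
  rewrite perm_sym; apply: perm_trans p1; rewrite perm_cat2r; apply: uniq_perm; first exact: fset_uniq.
    by rewrite filter_uniq // (reduced_uniq rE).
  by move=> j; rewrite mem_filter; apply/idP/andP => [jd|[]//]; split => //; exact: sub.
have Hhigh J : U [set i | high J (H i)].
  have : U [set i | forall j : int, [set j : int | (`|j| <= J)%N] j -> j \notin H i].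
    apply: (filter_finite (finite_interval J)) => j _ /=.
    have [jd|jd] := boolP (j \in ds).
      by apply: filterE => i; rewrite /= mem_filter jd.
    have /(ultra_notin UU) : ~ S j by move=> /dsS; rewrite (negbTE jd).
    by apply: filterS => i /= ji; rewrite mem_filter negb_and; apply/orP; right; exact/negP.
  apply: filterS => i h; apply/allP => j jH; rewrite ltnNge; apply/negP => /h.
  by rewrite jH.
exists (value b ds - v0), (fun i => rvec (H i)); split=> [K v|].
  have [J vJ] := pow_big (v + (value b ds - v0)) b_ge3.
  apply: filterS (filterI EH (Hhigh J)) => i [[rH tE] hH] /=; rewrite tE.
  by rewrite [v + (_ + value b (H i))]addrA; exact: lset_high hH vJ.
by apply: filterS EH => i [_ tE] /= /rvec_eq0 H0; rewrite tE H0 value_nil addr0.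
Qed.

End LabelSets.

(** * The two families of integer sets as one *)

Section LabelTimes.
Variables (b : nat) (D : nat -> set nat).
Hypothesis b_ge3 : (3 <= b)%N.
Hypothesis D_part : is_index_partition D.
Implicit Types (js : seq int) (M : label) (t : int).

Lemma reduced_pos js :
  reduced true js = reduced false js && all (fun j : int => 0 < j) js.
Proof.
rewrite /reduced -andbA; congr (_ && _); rewrite -all_predI; apply: eq_all => j /=.
by rewrite andbT; case: (j != 0).
Qed.

Lemma kfun_inj : injective (kfun b).
Proof.
have k0 j : kfun b j = 0 -> j = 0.
  move=> /eqP; rewrite mulf_eq0 sgr_eq0 expf_eq0 => /orP[/eqP //|/andP[_]].
  by move=> /eqP b0; move: b_ge3; lia.
move=> i j; have [->|i0] := eqVneq i 0.
  by rewrite {1}/kfun sgr0 mul0r => /esym/k0.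
have [->|j0 e] := eqVneq j 0; first by rewrite {2}/kfun sgr0 mul0r => /k0.
have r1 (x : int) : x != 0 -> reduced false [:: x] by move=> x0; rewrite /reduced /= x0.
have := reduced_unique b_ge3 (r1 i i0) (r1 j j0).
rewrite /value !big_seq1 => /(_ e) /perm_mem /(_ i).
by rewrite !inE eqxx => /esym/eqP.
Qed.

Lemma reduced_IP_of (J : set int) js : uniq js -> {in js, forall j, J j} ->
  IP_of b J (value b js).
Proof.
move=> ujs jJ; have := @seq_fsetE tt _ [seq kfun b j | j <- js].
move: (seq_fset _ _) => F FE; exists F.
  move=> u /=; rewrite FE => /mapP[j jjs ->]; exists j => //; exact: jJ.
rewrite /value -(big_map (kfun b) xpredT id); apply: perm_big.
rewrite perm_sym; apply: uniq_perm; first exact: fset_uniq.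
  by rewrite map_inj_uniq //; exact: kfun_inj.
by move=> u; rewrite FE.
Qed.

Lemma label_timesE M : label_times b D M = lset b D false M.
Proof.
apply/seteqP; split=> t.
- move=> [_ [m [js [sjs js0 tE] mE] Mm]]; exists js.
  have ajs : all (fun j : int => (j != 0) && (false ==> (0 < j))) js.
    by apply/allP => j jjs /=; rewrite andbT; apply: contraNneq js0 => <-.
  have -> : rvec D js = m.
    apply/msetP => l; rewrite mE rvecE; apply: eq_in_count => j jjs.
    rewrite (block_eq D_part) //; by have /andP[] := allP ajs j jjs.
  split => //; rewrite /reduced ajs andbT.
  have : sorted gtn [seq `|j|%N | j <- js] by rewrite sorted_map.
  by apply: sorted_uniq => [x y z h1 h2|x]; [exact: ltn_trans h2 h1|exact: ltnn].
- move=> [js [rjs tE Mjs]]; have ujs := reduced_uniq rjs; split.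
    by rewrite tE; exact: reduced_IP_of.
  have [u1 ajs] := andP rjs.
  pose leT (i j : int) := (`|j| <= `|i|)%N.
  have ps : perm_eq (sort leT js) js by exact: permEl (perm_sort _ _).
  exists (rvec D js) => //; exists (sort leT js).
    split.
    + have : sorted gtn [seq `|j|%N | j <- sort leT js].
        rewrite gtn_sorted_uniq_geq (perm_uniq (perm_map _ ps)) u1 /= sorted_map.
        by apply: sort_sorted => i j; exact: leq_total.
      by rewrite sorted_map.
    + by rewrite mem_sort; apply/negP => /(allP ajs); rewrite eqxx.
    + by rewrite tE; apply/esym; exact: perm_big.
  move=> l; rewrite rvecE -(permP ps); apply: eq_in_count => j.
  rewrite mem_sort => jjs; rewrite (block_eq D_part) //.
  by have /andP[] := allP ajs j jjs.
Qed.

(** A sum of positive terms is itself a reduced expansion, so by uniqueness it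
    is the one that witnesses membership. *)
Lemma label_times_plusE M : label_times_plus b D M = lset b D true M.
Proof.
rewrite /label_times_plus label_timesE; apply/seteqP; split=> t.
- move=> [[js [rjs tE Mjs]] [F FJ tF]]; exists js; split => //.
  have ex u : exists j : int, u \in F -> 0 <= j /\ kfun b j = u.
    have [uF|_] := boolP (u \in F); last by exists 0.
    by have [j j0 ju] := FJ u uF; exists j.
  have [g gP] := choice ex.
  pose js2 := [seq g u | u <- F & u != 0].
  have g_pos u : u \in F -> u != 0 -> 0 < g u.
    move=> /gP[gu0 gu] u0; rewrite lt0r gu0 andbT; apply: contraNneq u0 => g0.
    by rewrite -gu g0 /kfun sgr0 mul0r.
  have js2_pos : all (fun j : int => 0 < j) js2.
    by apply/allP => _ /mapP[u + ->]; rewrite mem_filter => /andP[u0 uF]; exact: g_pos.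
  have js2_red : reduced false js2.
    apply/andP; split; last by apply: sub_all js2_pos => j j0; rewrite gt_eqF.
    rewrite -map_comp map_inj_in_uniq ?filter_uniq ?fset_uniq // => u v.
    rewrite !mem_filter => /andP[u0 uF] /andP[v0 vF] /= guv.
    have [gu1 gu2] := gP u uF; have [gv1 gv2] := gP v vF.
    by rewrite -gu2 -gv2; congr kfun; lia.
  have v2 : value b js = value b js2.
    rewrite -tE tF /value /js2 big_map big_filter [RHS]big_mkcond /=.
    apply: eq_big_seq => u uF; case: eqP => [->//|_].
    by have [_ ->] := gP u uF.
  by rewrite reduced_pos rjs /= (perm_all _ (reduced_unique b_ge3 rjs js2_red v2)).
- move=> [js [rjs tE Mjs]]; move: (rjs); rewrite reduced_pos => /andP[rj pj]; split.
    by exists js.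
  rewrite tE; apply: reduced_IP_of; first exact: reduced_uniq rjs.
  by move=> j /(allP pj)/ltW.
Qed.

End LabelTimes.

(** * Windows and neighbourhoods of binary sequences *)

Definition win (L : nat) (x y : int -> bool) := forall t : int, (`|t| <= L)%N -> x t = y t.

Lemma win_le L L' x y : (L <= L')%N -> win L' x y -> win L x y.
Proof. by move=> LL h t tL; apply: h; exact: leq_trans LL. Qed.

Lemma nbhs_coord (x : Defs.bseq) (t : int) : nbhs x [set y : Defs.bseq | x t = y t].
Proof.
apply: (@nbhs_ptws _ _ x t [set c | x t = c]).
by rewrite nbhs_principalE; exact/principal_filterP.
Qed.

Lemma nbhs_win (x : Defs.bseq) L : nbhs x [set y : Defs.bseq | win L x y].
Proof.
apply: (filter_finite (U := nbhs x) (D := [set t : int | (`|t| <= L)%N])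
  (P := fun t => [set y : Defs.bseq | x t = y t])).
  exact: finite_interval.
by move=> t _; exact: nbhs_coord.
Qed.

Lemma win_nbhs (x : Defs.bseq) (B : set Defs.bseq) : nbhs x B ->
  exists L, forall y, win L x y -> B y.
Proof.
pose F := filter_from [set: nat] (fun L => [set y : Defs.bseq | win L x y]).
have FF : Filter F.
  apply: filter_from_filter; first by exists 0%N.
  move=> i j _ _; exists (maxn i j) => // y h.
  by split; apply: win_le h; rewrite ?leq_maxl ?leq_maxr.
suff : F --> x by move=> h /h[L _ LB]; exists L.
apply/cvg_sup => t U [? /= [[W oW <-]]] /= Wx /filterS; apply.
by exists `|t|%N => // y /(_ t (leqnn _)) /= <-.
Qed.

Section OrbitClosure.
Variable x0 : Defs.bseq.
Local Notation X := (orbit_closure Defs.shift x0).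
Local Notation T := (orbit_system Defs.shift x0).
Implicit Types x y : X.

Lemma nbhs_subP (y : X) (B : set X) :
  nbhs y B <-> exists L, forall z : X, win L (val y) (val z) -> B z.
Proof.
split.
  move=> [? /= [[W oW <-]]] /= Wy WB.
  have [L LW] := win_nbhs (open_nbhs_nbhs (conj oW Wy)).
  by exists L => z /LW Wz; exact: WB.
move=> [L LB]; apply: filterS LB _.
exact: (@nbhs_set_val Defs.bseq X y _ (nbhs_win _ L)).
Qed.

Lemma hpow_shiftE (n : int) (x : Defs.bseq) (t : int) :
  hpow Defs.shift n x t = x (t + n).
Proof.
case: n => n /=.
  elim: n t => [|n IH] t /=; first by rewrite addr0.
  by rewrite /shift_by IH; congr x; lia.
rewrite /shift_by; elim: n t => [|n IH] t /=; first by congr x; lia.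
by rewrite /shift_by IH; congr x; lia.
Qed.

Lemma val_hpow (n : int) (x : X) (t : int) : val (hpow T n x) t = val x (t + n).
Proof.
rewrite -hpow_shiftE; congr (_ _).
case: n => n /=; first by elim: n => [//|n IH]; rewrite !iterS -IH.
elim: n => [//|n IH]; rewrite iterS [in RHS]iterS -IH //.
Qed.

Lemma cluster_winP (f : nat -> X) (y : X) :
  cluster (f @ \oo) y <->
  forall L n, exists2 k, (n <= k)%N & win L (val y) (val (f k)).
Proof.
split=> [cy L n|h A B [n _ An] /nbhs_subP[L LB]].
  have [||z [[k nk <-] yz]] := cy [set f k | k in [set k | (n <= k)%N]]
      [set z : X | win L (val y) (val z)].
  - by exists n => // k /= nk; exists k.
  - by apply/nbhs_subP; exists L.
  - by exists k.
by have [k nk /LB Bk] := h L n; exists (f k); split => //; exact: An.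
Qed.

Lemma limit_pointsP (x y : X) : limit_points T x y <->
  forall L n, exists k : int, (n <= `|k|)%N /\ win L (val y) (shift_by k (val x)).
Proof.
have vw L (k : int) : win L (val y) (val (hpow T k x)) <-> win L (val y) (shift_by k (val x)).
  by split=> h t tL; rewrite h // val_hpow.
split=> [[] /cluster_winP h L n|h].
- by have [k nk /vw hk] := h L n; exists k%:Z.
- by have [k nk /vw hk] := h L n; exists (- k%:Z); rewrite abszN.
apply: contrapT => /not_orP[/cluster_winP h1 /cluster_winP h2].
have neg (f : nat -> X) : ~ (forall L n, exists2 k, (n <= k)%N & win L (val y) (val (f k))) ->
    exists L n, forall k, (n <= k)%N -> ~ win L (val y) (val (f k)).
  move=> /existsNP[L /existsNP[n nk]]; exists L, n => k kn hk.
  by apply: nk; exists k.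
have [L1 [n1 h1']] := neg _ h1; have [L2 [n2 h2']] := neg _ h2.
have [k [nk hk]] := h (maxn L1 L2) (maxn n1 n2).
have w1 := win_le (leq_maxl _ _) hk; have w2 := win_le (leq_maxr _ _) hk.
case: k nk {hk} w1 w2 => k nk w1 w2.
  by apply: (h1' k); [move: nk; rewrite geq_max => /andP[]|apply/vw].
apply: (h2' k.+1); first by move: nk; rewrite geq_max => /andP[].
by apply/vw; rewrite -NegzE.
Qed.

Lemma orbit_transitive : transitive_system T.
Proof.
have X0 : X x0 by apply: subset_closure; exists 0.
pose z : X := exist _ x0 (mem_set X0).
have dense (V : set X) : open V -> V !=set0 -> exists n : int, V (hpow T n z).
  move=> oV [y Vy]; have /nbhs_subP[L LV] := open_nbhs_nbhs (conj oV Vy).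
  have [_ [[n _ <-] yn]] := set_mem (valP y) _ (nbhs_win (val y) L).
  exists n; apply: LV => t tL; rewrite val_hpow /=.
  by rewrite yn // hpow_shiftE.
move=> U V oU oV U0 V0; have [m Um] := dense U oU U0; have [n Vn] := dense V oV V0.
exists (m - n), (hpow T n z); split => //=.
suff -> : hpow T (m - n) (hpow T n z) = hpow T m z by [].
by apply: val_inj; apply: funext => t; rewrite !val_hpow -addrA subrK.
Qed.

End OrbitClosure.

(** * The subshift of a label *)

Section LabelSubshift.
Variables (b : nat) (D : nat -> set nat).
Hypothesis b_ge3 : (3 <= b)%N.
Hypothesis D_part : is_index_partition D.
Variable pos : bool.
Variable M : label.
Hypotheses (sM : simple_label M) (fM : chainless M).
Implicit Types (K N : label) (Phi Psi : set label).

Local Notation lset := (lset b D pos).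
Local Notation A := (lset M).
Local Notation X := (orbit_closure Defs.shift (char_seq A)).
Local Notation T := (orbit_system Defs.shift (char_seq A)).

Definition lseq (c : int) (N : label) : Defs.bseq := fun v => `[< lset N (v + c) >].

Lemma lseq_empty c : lseq c empty_label = (fun=> false).
Proof. by apply: funext => v; apply/asboolP => -[js []]. Qed.

Lemma asbool_iff (P Q : Prop) : (P <-> Q) -> `[< P >] = `[< Q >].
Proof. by move=> PQ; apply/asboolP/asboolP => /PQ. Qed.

Lemma lseq_inj N N' c c' : chainless N -> N <> empty_label ->
  lseq c N = lseq c' N' -> N = N'.
Proof.
move=> fN /label_neq0 N0 e; apply: (lset_inj b_ge3 D_part (pos := pos) (c := c' - c) fN N0) => v.
have := congr1 (fun y : Defs.bseq => y (v - c)) e; rewrite /lseq subrK => h.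
have -> : v + (c' - c) = v - c + c' by rewrite addrA addrAC.
by split=> H; apply/asboolP; [rewrite -h|rewrite h]; apply/asboolP.
Qed.

Section Limits.
Variables (I : Type) (U : set_system I) (UU : UltraFilter U).

Lemma lset_ulim (N : I -> label) u : U [set i | lset (N i) u <-> lset (ulim UU N) u].
Proof.
have [[js [rjs ->]]|nu] := pselect (exists js, reduced pos js /\ u = value b js).
  apply: filterS (ultra_decide UU (A := [set i | (N i : set FIN) (rvec D js)]) id id) => i h.
  apply: iff_trans (lset_value D b_ge3 (N i) rjs) _.
  exact: iff_trans h (iff_sym (lset_value D b_ge3 (ulim UU N) rjs)).
by apply: filterE => i /=; split=> -[js [rjs e _]]; case: nu; exists js.
Qed.

Lemma lseq_ulim_win L c (N : I -> label) : U [set i | win L (lseq c (ulim UU N)) (lseq c (N i))].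
Proof.
apply: (filter_finite (U := U) (D := [set t : int | (`|t| <= L)%N])
  (P := fun t => [set i | lseq c (ulim UU N) t = lseq c (N i) t])).
  exact: finite_interval.
move=> t _; apply: filterS (lset_ulim N (t + c)) => i h.
by apply: asbool_iff; apply: iff_sym.
Qed.

(** Unless the limit vanishes, the translations split along the ultrafilter
    into a constant [d] and expansions with large indices, which act on the
    labels through their vectors [r i]. *)
Lemma lseq_limit (t : I -> int) (N : I -> label) (y : Defs.bseq) :
  U [set i | Theta M (N i)] -> (forall v, U [set i | y v = lseq (t i) (N i) v]) ->
  y = (fun=> false) \/
  exists d (r : I -> FIN),
    [/\ forall (K : I -> label) v,
          U [set i | lseq (t i) (K i) v = lseq d (shift_label (r i) (K i)) v],
        U [set i | r i = mset0 -> t i = d] &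
        y = lseq d (ulim UU (fun i => shift_label (r i) (N i)))].
Proof.
move=> TN yN; have [y0|] := pselect (forall v, y v = false).
  by left; apply: funext.
move=> /existsNP[v0] yv0; right.
have NM : U [set i | (N i : set FIN) `<=` (M : set FIN)].
  by apply: filterS TN => i /(Theta_sub sM).
have Ut : U [set i | lset (N i) (v0 + t i)].
  by apply: filterS (yN v0) => i /= h; apply/asboolP; rewrite -/(lseq _ _ _) -h; case: (y v0) yv0.
have [d [r [hK hr]]] := lset_ultra b_ge3 UU fM NM Ut.
have hK' (K : I -> label) v : U [set i | lseq (t i) (K i) v = lseq d (shift_label (r i) (K i)) v].
  by apply: filterS (hK K v) => i h; exact: asbool_iff.
exists d, r; split => //; apply: funext => v.
have hu := lset_ulim (fun i => shift_label (r i) (N i)) (v + d).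
have [i [[/= -> ->] h]] := filter_ex (filterI (filterI (yN v) (hK' N v)) hu).
exact: asbool_iff.
Qed.

End Limits.

(** An expansion of [r] with large indices serves; its indices are taken
    positive so that its value is large. *)
Lemma lseq_approx N r c L n0 : exists t : int,
  (r <> mset0 -> (n0 <= `|t|)%N) /\ win L (lseq (c + t) N) (lseq c (shift_label r N)).
Proof.
have [J vJ] := pow_big ((L + `|c| + n0)%N%:Z) b_ge3.
have [h [rh hh hr]] := high_vector D_part r J.
exists (value b h); split=> [r0|v vL].
  have {r0} h0 : h != [::] by apply: contra_notN r0 => /eqP h0; rewrite -hr h0 rvec_nil.
  move: (rh true) => {rh hr}; case: h h0 hh => [//|j h] _ /andP[Jj _] /andP[_ ph].
  have h_ge0 : 0 <= value b h.
    rewrite /value big_seq; apply: sumr_ge0 => i ih.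
    have /andP[_ /= i0] : (i != 0) && (true ==> (0 < i)) by apply: (allP ph); rewrite inE ih orbT.
    by rewrite /kfun gtr0_sg // mul1r exprn_ge0.
  have j0 : 0 < j by move: ph => /= /andP[/andP[]].
  have jJ : b%:Z ^+ J <= kfun b j.
    by rewrite /kfun gtr0_sg // mul1r ler_eXn2l ?ltz_nat; lia.
  rewrite /value big_cons -/(value b h) -lez_nat abszE ger0_norm; last first.
    by apply: addr_ge0 => //; apply: le_trans jJ; exact: exprn_ge0.
  by move: vJ jJ h_ge0; set p := _ ^+ J; set q := kfun b j; set s := value b h; lia.
apply: asbool_iff; rewrite -hr addrA; apply: (lset_high D b_ge3 _ (rh pos) hh).
by move: vJ; set p := _ ^+ J; lia.
Qed.

Lemma lseq_mem c N : Theta M N -> X (lseq c N).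
Proof.
move=> /(ThetaP sM)[r ->] B /win_nbhs[L LB].
have [t [_ ht]] := lseq_approx M r c L 0.
exists (hpow Defs.shift (c + t) (char_seq A)); split; first by exists (c + t).
apply: LB => v vL; rewrite hpow_shiftE -ht //.
Qed.

Definition point c N (TN : Theta M N) : X := exist _ (lseq c N) (mem_set (lseq_mem (c := c) TN)).

(** The correspondence [Xset] from sets of labels to subsets of the subshift
    carries the label iterations to the iterations of the system. *)
Definition Xset Phi : set X := [set x | exists c N, Phi N /\ val x = lseq c N].

Lemma Xset_mem Phi x c N : Phi empty_label -> Theta M N -> Xset Phi x -> val x = lseq c N -> Phi N.
Proof.
move=> P0 TN [c' [N' [PN' ->]]] e.
have [->//|N0] := pselect (N = empty_label).
have fN := chainless_sub fM (Theta_sub sM TN).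
by rewrite (lseq_inj fN N0 (esym e)).
Qed.

Lemma Xset_inj Phi Psi : Phi `<=` Theta M -> Psi `<=` Theta M ->
  Phi empty_label -> Psi empty_label -> Xset Phi = Xset Psi -> Phi = Psi.
Proof.
move=> PT QT P0 Q0 e; apply/seteqP; split => N NP.
  have : Xset Phi (point 0 (PT _ NP)) by exists 0, N.
  by rewrite e => /(Xset_mem (c := 0) (N := N) Q0 (PT _ NP)); apply.
have : Xset Psi (point 0 (QT _ NP)) by exists 0, N.
by rewrite -e => /(Xset_mem (c := 0) (N := N) P0 (QT _ NP)); apply.
Qed.

Lemma Xset_Theta : Xset (Theta M) = [set: X].
Proof.
apply/seteqP; split => // y _.
have /closure_ultra[U [UU UX sU]] := set_mem (valP y).
have ex z : exists n : int, range (fun n : int => hpow Defs.shift n (char_seq A)) z ->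
    z = hpow Defs.shift n (char_seq A).
  have [[n _ <-]|nz] := pselect (range (fun n : int => hpow Defs.shift n (char_seq A)) z).
    by exists n.
  by exists 0.
have [t tP] := choice ex.
have hT : U [set z | Theta M M] by apply: filterE => z; exact: Theta_self.
have hv v : U [set z | val y v = lseq (t z) M v].
  apply: filterS (filterI UX (sU _ (nbhs_coord (val y) v))) => z [/tP zE /= ->].
  by rewrite {1}zE hpow_shiftE.
have [e|[d [r [_ _ e]]]] := lseq_limit UU hT hv.
  by exists 0, empty_label; rewrite lseq_empty; split => //; exact: Theta_empty.
exists d, (ulim UU (fun i => shift_label (r i) M)); split => //.
apply: ulim_closure; apply: filterE => i /=; by exists (r i).
Qed.

Lemma XsetP (x : X) : exists c N, Theta M N /\ val x = lseq c N.
Proof. by have : [set: X] x by []; rewrite -Xset_Theta. Qed.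

Lemma Xset_closed Phi : good M Phi -> closure (Xset Phi) `<=` Xset Phi.
Proof.
move=> [cP iP PT P0] y /closure_ultra[U [UU UX sU]].
have ex z : exists cN : int * label, Xset Phi z -> Phi cN.2 /\ val z = lseq cN.1 cN.2.
  have [[c [N [PN zE]]]|nz] := pselect (Xset Phi z); first by exists (c, N).
  by exists (0, empty_label).
have [g gP] := choice ex.
have hT : U [set z | Theta M (g z).2] by apply: filterS UX => z /gP[/PT].
have hv v : U [set z | val y v = lseq (g z).1 (g z).2 v].
  have nv : nbhs y [set z : X | val y v = val z v].
    exact: (@nbhs_set_val Defs.bseq X y _ (nbhs_coord _ v)).
  by apply: filterS (filterI UX (sU _ nv)) => z [/gP[_ zE] /= ->]; rewrite zE.
have [e|[d [r [_ _ e]]]] := lseq_limit UU hT hv.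
  by exists 0, empty_label; rewrite lseq_empty.
exists d, (ulim UU (fun z => shift_label (r z) (g z).2)); split => //.
by apply: cP; apply: ulim_closure; apply: filterS UX => z /gP[h _]; exact: iP.
Qed.

(** Translations that tend to infinity have, apart from a constant, a nonzero
    vector, so they produce exactly the limits of nonzero translates. *)
Lemma limit_points_lseq (x : X) c N : Theta M N -> val x = lseq c N ->
  limit_points T x = Xset (Theta' N).
Proof.
move=> TN xE; apply/seteqP; split => y.
- move=> /limit_pointsP hy.
  pose S (L : nat) := [set k : int | (L <= `|k|)%N /\ win L (val y) (shift_by k (val x))].
  have PF : ProperFilter (filter_from [set: nat] S).
    apply: filter_from_proper; last by move=> L _; have [k] := hy L L; exists k.
    apply: filter_from_filter; first by exists 0%N.
    move=> i j _ _; exists (maxn i j) => // k [].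
    rewrite geq_max => /andP[ik jk] w; split; split => //.
      exact: win_le (leq_maxl _ _) w.
    exact: win_le (leq_maxr _ _) w.
  have [U [UU sU]] := ultraFilterLemma PF.
  have US L : U (S L) by apply: sU; exists L.
  have hT : U [set k : int | Theta M N] by exact: filterE.
  have hv v : U [set k : int | val y v = lseq (k + c) N v].
    apply: filterS (US `|v|%N) => k [_ /(_ v (leqnn _))] /= ->.
    by rewrite /shift_by xE /lseq addrA.
  have [e|[d [r [_ hr e]]]] := lseq_limit UU hT hv.
    exists 0, empty_label; rewrite lseq_empty; split => //.
    exact: (Theta'_empty sM fM TN).
  exists d, (ulim UU (fun k => shift_label (r k) N)); split => //.
  apply: ulim_closure; apply: filterS (filterI hr (US `|d - c|.+1)) => k [/= rk [dk _]].
  exists (r k) => //; apply/eqP => /rk kd; move: dk; rewrite -kd; lia.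
- move=> [c' [N' [TN' yE]]]; apply/limit_pointsP => L n.
  move: TN'; rewrite (Theta'_simple sM fM) // => -[r /eqP r0 rN].
  have [t [tn ht]] := lseq_approx N r c' L (n + `|c' - c|)%N.
  exists (c' + t - c); split; first by have := tn r0; lia.
  move=> v vL; rewrite yE -rN -ht // /shift_by xE /lseq.
  by congr `[< lset _ _ >]; lia.
Qed.

Lemma zLIM_Xset Phi : good M Phi -> zLIM T (Xset Phi) = Xset (zLAB Phi).
Proof.
move=> gP; have [_ _ PT _] := gP; apply/seteqP; split.
- move=> y0 hy0; apply: (Xset_closed (good_zLAB gP)).
  move: y0 hy0; apply: closureS.
  move=> y [x [c [N [PN xE]]]]; rewrite (limit_points_lseq (PT _ PN) xE).
  move=> [c' [N' [TN' yE]]]; exists c', N'; split => //.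
  by move: N' TN' {yE}; apply: closureS => _ [r r0 <-]; exists r => //; exists N.
- move=> y [c [N [/closure_ulim[U [UU [UP <-]]] yE]]] B /nbhs_subP[L LB].
  have [N' [[r r0 [N0 PN0 rN]] hw]] := filter_ex (filterI UP (lseq_ulim_win UU L c id)).
  have TN' : Theta M N' by rewrite -rN; exact: Theta_shift (PT _ PN0).
  exists (point c TN'); split; last by apply: LB => t tL; rewrite yE hw.
  exists (point 0 (PT _ PN0)); first by exists 0, N0.
  rewrite (limit_points_lseq (c := 0) (PT _ PN0)) //; exists c, N'; split => //.
  by apply: subset_closure; exists r.
Qed.

Lemma zLIM_star_Xset Phi : Phi empty_label ->
  zLIM_star T (Xset Phi) = Xset (zLAB_star M Phi).
Proof.
move=> P0; apply/seteqP; split => x.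
- have [c [N [TN xE]]] := XsetP x.
  rewrite /zLIM_star /= (limit_points_lseq TN xE) => NP.
  exists c, N; split => //; split => // N' TN'.
  have TN'' := Theta'_sub sM fM TN TN'.
  apply: (@Xset_mem _ (point 0 TN'') 0) => //.
  by apply: NP; exists 0, N'.
- move=> [c [N [[TN NP] xE]]]; rewrite /zLIM_star /= (limit_points_lseq TN xE).
  by move=> y [c' [N' [/NP PN' yE]]]; exists c', N'.
Qed.

Lemma dec_stage_Xset (o : Ord) (w : o) :
  dec_stage (zLIM T) [set: X] w = Xset (dec_stage zLAB (Theta M) w).
Proof.
elim/(well_founded_ind (@ord_wf o)): w => w IH.
case: (ord_kinds w) => [w0|[v vw]|wl]; rewrite /dec_stage.
- by rewrite !stage_zero // Xset_Theta.
- rewrite !(stage_succ _ _ _ vw) -/(dec_stage _ _ v) -[in RHS]/(dec_stage _ _ v).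
  rewrite IH; last by case: vw.
  by apply: zLIM_Xset; case: (label_stage_mono sM fM v).
- rewrite !stage_limit //; apply/seteqP; split => x.
    move=> hx; have [c [N [TN xE]]] := XsetP x.
    exists c, N; split => // _ [v vw <-].
    have [[_ _ _ z0] _] := label_stage_mono sM fM v.
    apply: (Xset_mem z0 TN _ xE).
    by rewrite -IH //; apply: hx; exists v.
  move=> [c [N [hN xE]]] _ [v vw <-].
  rewrite -[stage _ _ _ v]/(dec_stage _ _ v) IH //; exists c, N; split => //.
  by apply: hN; exists v.
Qed.

Lemma inc_stage_Xset (e : X) (o : Ord) (w : o) : val e = (fun=> false) ->
  inc_stage (zLIM_star T) [set e] w =
  Xset (inc_stage (zLAB_star M) [set empty_label] w).
Proof.
move=> eE; elim/(well_founded_ind (@ord_wf o)): w => w IH.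
case: (ord_kinds w) => [w0|[v vw]|wl]; rewrite /inc_stage.
- rewrite !stage_zero //; apply/seteqP; split=> [_ ->|x [c [_ [-> xE]]]].
    by exists 0, empty_label; rewrite lseq_empty.
  by apply: val_inj; rewrite /= eE xE lseq_empty.
- rewrite !(stage_succ _ _ _ vw) -/(inc_stage _ _ v) -[in RHS]/(inc_stage _ _ v).
  rewrite IH; last by case: vw.
  by apply: zLIM_star_Xset; case: (star_stage_mono sM fM v) => -[].
- rewrite !stage_limit //; apply/seteqP; split => x.
    move=> [_ [v vw <-]]; rewrite -/(inc_stage _ _ v) IH // => -[c [N [hN xE]]].
    by exists c, N; split => //; exists (inc_stage (zLAB_star M) [set empty_label] v) => //; exists v.
  move=> [c [N [[_ [v vw <-] hN] xE]]].
  exists (inc_stage (zLIM_star T) [set e] v); first by exists v.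
  by rewrite IH //; exists c, N.
Qed.

Lemma zLAB_finite : zLAB [set empty_label; zero_label] = [set empty_label].
Proof.
apply/seteqP; split=> [N /closure_ulim[U [UU [UP <-]]]|_ ->].
  apply: ulim_const; apply: filterS UP => _ [r /eqP r0 [N' [->|->] <-]].
    exact: shift_label_empty.
  exact: shift_zero_label.
apply: subset_closure; exists [mset 0%N]%mset.
  by apply/eqP => /msetP/(_ 0%N); rewrite msetnxx mset0E.
by exists empty_label; [left|exact: shift_label_empty].
Qed.

Lemma zLAB_empty : zLAB [set empty_label] = [set empty_label].
Proof.
apply/seteqP; split=> [N /closure_ulim[U [UU [UP <-]]]|_ ->].
  apply: ulim_const; apply: filterS UP => _ [r _ [_ -> <-]].
  exact: shift_label_empty.
apply: subset_closure; exists [mset 0%N]%mset.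
  by apply/eqP => /msetP/(_ 0%N); rewrite msetnxx mset0E.
by exists empty_label => //; exact: shift_label_empty.
Qed.

Lemma label_system_height (a : Ord) : label_height_succ M a -> system_height T (osucc a).
Proof.
move=> [_ _ hM]; rewrite /system_height.
set o := osucc (osucc a); pose z (w : o) := dec_stage zLAB (Theta M) w.
have zgood w : good M (z w) by case: (label_stage_mono sM fM w).
have zS : z (Some None) = [set empty_label; zero_label].
  by rewrite -hM /z /dec_iter /dec_stage (stage_Some _ _ _ (a := osucc a)).
have zN : z None = [set empty_label].
  by rewrite /z /dec_stage (stage_succ _ _ _ (is_succ_None a)) -/(dec_stage _ _ _) -/(z _) zS zLAB_finite.
split.
  rewrite dec_stage_Xset -/(z None) zLIM_Xset; last exact: zgood.
  by rewrite zN zLAB_empty.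
move=> g; rewrite dec_stage_Xset -/(z (Some g)) zLIM_Xset; last exact: zgood.
have [_ _ T1 e1] := zgood (Some g); have [_ _ T2 e2] := good_zLAB (zgood (Some g)).
move=> /(Xset_inj T1 T2 e1 e2)/esym fx.
have mono (v w : o) : ord_lt v w -> z w `<=` z v.
  by move=> vw; have [_] := label_stage_mono sM fM w; exact.
have fixed := dec_stage_fixed mono fx.
have e3 : z None = z (Some g) by apply: fixed; right.
have e4 : z (Some None) = z (Some g).
  by apply: fixed; case: (g) => [u|]; [right|left].
have : z None zero_label by rewrite e3 -e4 zS; right.
by rewrite zN; exact: (iffRL (label_neq0 zero_label) erefl).
Qed.

(** A limit [p] of powers of the shift is zero everywhere, or it acts on every
    point as one translation of the line followed by one translation [s] of the
    label. In the second case approach a point [x] by points [y]: if [x] is not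
    zero, the labels of the [y] converge up to far translations, which commute
    with [s]; if [x] is zero, so is the limit of the [p y], because translating
    a label only shrinks its set. *)
Lemma label_wap : wap_system T.
Proof.
move=> p /closure_ultra[U [UU UA sU]].
have ex f : exists n : int, range (hpow T) f -> f = hpow T n.
  have [[n _ nf]|nf] := pselect (range (hpow T) f); first by exists n.
  by exists 0.
have [t tP] := choice ex.
have hp (x : X) v : U [set f : {ptws X -> X} | val (p x) v = val (f x) v].
  apply: sU; apply: (@nbhs_ptws X X p x [set y : X | val (p x) v = val y v]).
  exact: (@nbhs_set_val Defs.bseq X (p x) _ (nbhs_coord _ v)).
have hpt (x : X) c N v : val x = lseq c N ->
    U [set f : {ptws X -> X} | val (p x) v = lseq (t f + c) N v].
  move=> xE; apply: filterS (filterI UA (hp x v)) => f [/tP fE /= ->].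
  by rewrite {1}fE val_hpow xE /lseq addrA.
have [pe|] := pselect (forall x, val (p x) = (fun=> false)).
  have -> : p = cst (p (point 0 (Theta_self sM))).
    by apply: funext => y; apply: val_inj; rewrite !pe.
  exact: cst_continuous.
move=> /existsNP[x0 px0]; have [c0 [N0 [TN0 x0E]]] := XsetP x0.
have hT0 : U [set f : {ptws X -> X} | Theta M N0] by exact: filterE.
have [//|[d [r [hK _ _]]]] := lseq_limit UU hT0 (fun v => hpt x0 c0 N0 v x0E).
have [s hs] := ulim_shift_simple sM UU r.
(* the constants do not depend on the point, as [r] comes from [x0] alone *)
have pE (x : X) c N : Theta M N -> val x = lseq c N ->
    val (p x) = lseq (d - c0 + c) (shift_label s N).
  move=> TN xE; apply: funext => v.
  have h1 := hK (fun=> N) (v - c0 + c).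
  have h2 := lset_ulim UU (fun f => shift_label (r f) N) (v + (d - c0 + c)).
  have [f [[/= h3 h4] h5]] := filter_ex (filterI (filterI (hpt x c N v xE) h1) h2).
  rewrite h3; transitivity (lseq (t f + c0) N (v - c0 + c)).
    by rewrite /lseq; congr `[< lset _ _ >]; lia.
  rewrite h4 /lseq -hs //; apply: asbool_iff.
  by have -> : v - c0 + c + d = v + (d - c0 + c) by lia.
move=> x B /nbhs_subP[L LB].
suff : nbhs x [set y : X | win L (val (p x)) (val (p y))].
  by apply: filterS => y; exact: LB.
apply: (filter_finite (U := nbhs x) (D := [set v : int | (`|v| <= L)%N])
  (P := fun v => [set y : X | val (p x) v = val (p y) v])).
  exact: finite_interval.
move=> v _ {B L LB}; apply: contrapT => nx.
pose Q := [set y : X | val (p x) v <> val (p y) v].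
have clQ : closure Q x.
  move=> B nB; apply: contrapT => nQ; apply: nx; apply: filterS nB => y By.
  by apply: contrapT => h; apply: nQ; exists y.
have [V [VV VQ sV]] := closure_ultra clQ.
have exN (y : X) : exists cN : int * label, Theta M cN.2 /\ val y = lseq cN.1 cN.2.
  by have [c [N h]] := XsetP y; exists (c, N).
have [g gP] := choice exN.
have hT : V [set y | Theta M (g y).2] by apply: filterE => y /=; case: (gP y).
have hv u : V [set y : X | val x u = lseq (g y).1 (g y).2 u].
  have nu : nbhs x [set y : X | val x u = val y u].
    exact: (@nbhs_set_val Defs.bseq X x _ (nbhs_coord _ u)).
  by apply: filterS (sV _ nu) => y /= ->; have [_ ->] := gP y.
have pg (y : X) u : val (p y) u = lseq (g y).1 (shift_label s (g y).2) (u + (d - c0)).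
  have [TN yE] := gP y; rewrite (pE y _ _ TN yE) /lseq.
  by congr `[< lset _ _ >]; lia.
have [xE|[d' [r' [hK' _ xE]]]] := lseq_limit VV hT hv.
  have px : val (p x) = (fun=> false).
    rewrite (pE x 0 empty_label) ?shift_label_empty ?lseq_empty //.
    exact: Theta_empty.
  have [y [/= h1 h2]] := filter_ex (filterI VQ (hv (v + (d - c0)))).
  apply: h1; rewrite px pg; apply/esym/asboolP => /lset_mono h3.
  have : val x (v + (d - c0)) = true.
    by apply: etrans h2 _; apply/asboolP; apply: h3; exact: shift_label_sub.
  by rewrite xE.
set N' := ulim VV _ in xE.
have TN' : Theta M N'.
  apply: (closed_closure (A := [set shift_label r M | r in [set: FIN]])).
  apply: ulim_closure; apply: filterS hT => y TN; exact: Theta_shift TN.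
have h1 := hK' (fun y => shift_label s (g y).2) (v + (d - c0)).
have h2 := lset_ulim VV (fun y => shift_label (r' y) (shift_label s (g y).2)) (v + (d - c0) + d').
have [y [[/= h3 h4] h5]] := filter_ex (filterI (filterI VQ h1) h2).
have e1 : val (p x) v = _ := congr1 (fun u : Defs.bseq => u v) (pE x d' N' TN' xE).
apply: h3; apply: (etrans e1); apply: etrans (esym (pg y v)).
rewrite h4 /lseq; apply: asbool_iff.
have -> : v + (d - c0 + d') = v + (d - c0) + d' by lia.
apply: iff_trans (iff_sym h5).
suff -> : shift_label s N' =
    ulim VV (fun y => shift_label (r' y) (shift_label s (g y).2)) by [].
rewrite /N' -ulim_shift; congr (ulim _ _); apply: funext => z.
by rewrite !shift_labelD msetDC.
Qed.

Lemma label_system_height_star (a : Ord) : label_height_star_succ M a ->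
  exists e : X, set_val e = (fun=> false) /\ system_height_star T e (osucc a).
Proof.
move=> [M0 _ hM]; have T0 := Theta_empty sM fM.
pose e := point 0 T0; have eE : val e = (fun=> false) := lseq_empty 0.
exists e; split; first exact: eE.
set o := osucc (osucc a); pose z (w : o) := inc_stage (zLAB_star M) [set empty_label] w.
have zS : z (Some None) = Theta' M.
  by rewrite -hM /z /inc_iter /inc_stage (stage_Some _ _ _ (a := osucc a)).
have zN : z None = Theta M.
  rewrite /z /inc_stage (stage_succ _ _ _ (is_succ_None a)) -/(inc_stage _ _ _) -/(z _) zS.
  apply/seteqP; split=> [N []//|N TN]; split => //.
  rewrite !(Theta'_simple sM fM) //; last exact: Theta_self.
  have /(ThetaP sM)[q ->] := TN => _ [r /eqP/mset_neq0_ex[l rl] <-].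
  rewrite shift_labelD; exists (q `+` r)%mset => //.
  by apply/eqP/mset_neq0_ex; exists l; rewrite msetE2 addn_eq0 negb_and rl orbT.
split.
- exact: label_wap.
- by apply: val_inj; apply: funext => v; rewrite (val_hpow 1 e) eE.
- apply/seteqP; split => x /=.
    have [c [N [TN xE]]] := XsetP x; rewrite (limit_points_lseq TN xE) => xx.
    have NN := Xset_mem (Theta'_empty sM fM TN) TN xx xE.
    have N0 := chainless_recurrent sM fM TN NN.
    by apply: val_inj; rewrite eE xE N0 lseq_empty.
  move=> ->; rewrite (limit_points_lseq (c := 0) T0) //.
  by exists 0, empty_label; split => //; exact: (Theta'_empty sM fM T0).
- split; first by rewrite (inc_stage_Xset _ eE) -/(z None) zN Xset_Theta.
  move=> g; rewrite (inc_stage_Xset _ eE) -/(z (Some g)) => zg.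
  have TM := Theta_self sM.
  have [[_ z0 _] _] := star_stage_mono sM fM (Some g : o).
  have Mg : z (Some g) M.
    by apply: (@Xset_mem _ (point 0 TM) 0) => //; rewrite zg.
  have MS : z (Some None) M.
    case: g {zg z0} Mg => [u|//]; have [_] := star_stage_mono sM fM (Some None : o).
    exact.
  by move: MS; rewrite zS => /(chainless_recurrent sM fM TM).
Qed.

End LabelSubshift.

Local Close Scope ring_scope.

Theorem theorem5p35 :
  (forall a : Ord, countable_ordinal a -> is_limit_ordinal a ->
     exists M : label,
       [/\ simple_label M, finitary_label M,
           label_height_succ M a & label_height_star_succ M a]) /\
  (forall a : Ord, countable_ordinal a ->
     exists M : label,
       [/\ simple_label M, finitary_label M & label_height_succ M a]) /\
  (forall (b : nat) (D : nat -> set nat),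
     odd b -> (5 <= b)%N -> is_index_partition D ->
     forall (a : Ord) (M : label),
       countable_ordinal a ->
       simple_label M -> finitary_label M -> label_height_succ M a ->
       forall A : set int,
         A = label_times b D M \/ A = label_times_plus b D M ->
         [/\ transitive_system (subshift_map A),
             wap_system (subshift_map A),
             system_height (subshift_map A) (osucc a) &
             is_limit_ordinal a -> label_height_star_succ M a ->
             exists e : subshift A,
               set_val e = (fun=> false) /\
               system_height_star (subshift_map A) e (osucc a)]).
Proof.
split; last split.
- by move=> a ca _; exact: exists_label.
- by move=> a /exists_label[M [sM fM hM _]]; exists M.
move=> b D _ b5 D_part a M _ sM /finitary_chainless fM hM A AE.
have b3 : (3 <= b)%N by apply: leq_trans b5.
suff [pos ->] : exists pos, A = lset b D pos M.
  split.
  - exact: orbit_transitive.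
  - exact: label_wap.
  - exact: label_system_height.
  - by move=> _; exact: label_system_height_star.
case: AE => ->; first by exists false; exact: label_timesE.
by exists true; exact: label_times_plusE.
Qed.
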